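(* Let $\mathcal{T}$ be a compact nonnegative self-adjoint operator in a Hilbert space $\mathcal{H}$ with spectral asymptotics $$\mathcal{N}(t,\mathcal{T})\sim \frac{\varphi(1/t)\, s(\ln(1/t))}{t^{1/p}},\qquad t\to+0,$$ where $p>0$, $\varphi$ is a slowly varying function and $s$ is a continuous periodic function with period $T$. Let $\widetilde{\mathcal{T}}$ be a compact nonnegative self-adjoint operator in a Hilbert space $\widetilde{\mathcal{H}}$, with eigenvalues $\widetilde\lambda_k$, such that $$\mathcal{N}(t,\widetilde{\mathcal{T}})=O(t^{-1/\widetilde p}),\qquad t\to+0,\qquad \widetilde p>p.$$ Then the operator $\mathcal{T}\otimes\widetilde{\mathcal{T}}$ in the Hilbert space $\mathcal{H}\otimes\widetilde{\mathcal{H}}$ has the asymptotics $$\mathcal{N}(t,\mathcal{T}\otimes\widetilde{\mathcal{T}})\sim \frac{\varphi(1/t)\, s^*(\ln(1/t))}{t^{1/p}},\qquad t\to+0,$$ where $$s^*(\tau):=\sum_k s(\tau+\ln\widetilde\lambda_k)\,\widetilde\lambda_k^{1/p}$$ is a periodic function with period $T$ (the series converges, since $\widetilde p>p$).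
   Context: For a compact nonnegative self-adjoint operator $\mathcal{T}$ in a Hilbert space, $\lambda_n=\lambda_n(\mathcal{T})$ denote its positive eigenvalues arranged in nonincreasing order and repeated according to multiplicity, and $\mathcal{N}(t,\mathcal{T})=\#\{n:\lambda_n(\mathcal{T})>t\}$ for $t>0$. Similarly $\widetilde\lambda_k$ are the positive eigenvalues of $\widetilde{\mathcal{T}}$. The relation $f\sim g$ means $f=g\,(1+o(1))$. A positive (measurable) function $\varphi(\tau)$, $\tau>0$, is called slowly varying if $\varphi(c\tau)/\varphi(\tau)\to1$ as $\tau\to+\infty$ for every constant $c>0$. Standing assumptions: periodic functions in the spectral asymptotics are continuous and positive (hence bounded and separated from zero), and slowly varying functions in the spectral asymptotics are $C^2$-smooth with $\tau(\ln\varphi)'(\tau)\to0$ and $\tau^2(\ln\varphi)''(\tau)\to0$ as $\tau\to\infty$. *)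

(* Defs.v *)
From HB Require Import structures.
From mathcomp Require Import all_boot all_order all_algebra.
From mathcomp Require Import finmap sesquilinear complex.
From mathcomp Require Import all_classical all_reals all_analysis.

Set Implicit Arguments.
Unset Strict Implicit.
Unset Printing Implicit Defensive.

Import Order.TTheory GRing.Theory Num.Theory.
Import numFieldNormedType.Exports.

Local Open Scope classical_set_scope.
Local Open Scope ring_scope.

(** The Hilbert spaces below are over the complex numbers [R[i]] if
    [cplx = true] and over the reals [R] if [cplx = false]. *)
Definition base_field (R : realType) (cplx : bool) : numFieldType :=
  if cplx then (R[i] : numFieldType) else (R : numFieldType).

Definition sconj (R : realType) (cplx : bool) :
    base_field R cplx -> base_field R cplx :=
  if cplx as b return base_field R b -> base_field R b
  then (Num.conj : R[i] -> R[i]) else id.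

Definition of_real (R : realType) (cplx : bool) : R -> base_field R cplx :=
  if cplx as b return R -> base_field R b then real_complex R else id.

(** [inner] is linear in its first argument and conjugate-linear in the second;
    [{dot _ for _}] provides Hermitian symmetry and positive definiteness. *)
Record hilbert (R : realType) (cplx : bool) := Hilbert {
  hilbert_space :> completeNormedModType (base_field R cplx);
  inner : {dot hilbert_space for @sconj R cplx};
  inner_norm : forall x : hilbert_space, inner x x = `|x| ^+ 2 }.

Section Operators.
Variables (R : realType) (cplx : bool) (H : hilbert R cplx).
Implicit Types T : {linear H -> H}.

Definition compact_operator T := precompact (T @` [set x : H | `|x| <= 1]).

Definition self_adjoint T :=
  forall x y : H, inner H (T x) y = inner H x (T y).

Definition nonnegative T := forall x : H, 0 <= inner H (T x) x.

Definition compact_nonneg_sa T :=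
  [/\ compact_operator T, self_adjoint T & nonnegative T].

Definition eigenspace_of T (mu : R) : set H :=
  [set x : H | T x = of_real cplx mu *: x].

Definition has_dim (V : set H) (d : nat) :=
  exists e : 'I_d -> H, (forall i, V (e i)) /\
    forall v, V v ->
      exists! c : {ffun 'I_d -> base_field R cplx}, v = \sum_i c i *: e i.

(** The positive eigenvalues in nonincreasing order, repeated according to
    multiplicity; when there are only finitely many of them, the sequence is
    continued by zeros, which do not count as members of the list. *)
Definition is_eigenvalue_seq T (lam : nat -> R) :=
  [/\ nonincreasing_seq lam,
      forall n, 0 <= lam n &
      forall mu : R, 0 < mu -> exists d : nat,
        has_dim (eigenspace_of T mu) d /\ ([set n | lam n = mu] #= `I_d)%card].

(** [is_eigenvalue_seq T] has exactly one element when [T] is compact,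
    self-adjoint and nonnegative; otherwise the value is irrelevant. *)
Definition eigval_seq T : nat -> R :=
  xget (fun=> 0) [set lam | is_eigenvalue_seq T lam].

Definition counting_function T (t : R) : R :=
  (#|` fset_set [set n | (t < eigval_seq T n)%R]|%fset)%:R.

End Operators.

(** The Hilbert tensor product: a Hilbert space [L] with a bilinear map
    [H1 * H2 -> L] multiplicative on inner products, the finite sums of simple
    tensors being dense in [L] (that is, [L] is a completion of the algebraic
    tensor product). These data are unique up to a unitary isomorphism. *)
Record hilbert_tensor (R : realType) (cplx : bool) (H1 H2 : hilbert R cplx) :=
  HilbertTensor {
  tensor_space :> hilbert R cplx;
  tens : {bilinear H1 -> H2 -> tensor_space};
  inner_tens : forall (x x' : H1) (y y' : H2),
    inner tensor_space (tens x y) (tens x' y') = inner H1 x x' * inner H2 y y';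
  dense_tens : dense [set z : tensor_space |
    exists n (x : 'I_n -> H1) (y : 'I_n -> H2), z = \sum_i tens (x i) (y i)] }.

(** For bounded [T1] and [T2] there is exactly one such operator [A]. *)
Definition is_tensor_operator (R : realType) (cplx : bool)
    (H1 H2 : hilbert R cplx) (L : hilbert_tensor H1 H2)
    (T1 : {linear H1 -> H1}) (T2 : {linear H2 -> H2}) (A : {linear L -> L}) :=
  continuous A /\
  forall (x : H1) (y : H2), A (tens L x y) = tens L (T1 x) (T2 y).

Section Asymptotics.
Variable R : realType.

Definition slowly_varying (phi : R -> R) :=
  [/\ forall tau, 0 < tau -> 0 < phi tau,
      measurable_fun (`]0, +oo[ : set R) phi &
      forall c, 0 < c -> phi (c * tau) / phi tau @[tau --> +oo] --> (1 : R)].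

Definition C2_on_positive (phi : R -> R) :=
  forall tau : R, 0 < tau ->
    [/\ derivable phi tau 1, derivable (phi^`())%classic tau 1
      & {for tau, continuous (phi^`(2))%classic}].

Definition smooth_slowly_varying (phi : R -> R) :=
  [/\ slowly_varying phi, C2_on_positive phi,
      tau * ((@ln R \o phi)^`())%classic tau @[tau --> +oo] --> (0 : R) &
      tau ^+ 2 * ((@ln R \o phi)^`(2))%classic tau @[tau --> +oo] --> (0 : R)].

Definition almost_regular (phi s : R -> R) (p : R) (t : R) : R :=
  phi t^-1 * s (ln t^-1) / t `^ p^-1.

Definition has_period (f : R -> R) (per : R) := 0 < per /\ periodic f per.

(** The restriction to positive eigenvalues discards the zero padding. *)
Definition s_star_term (s : R -> R) (p : R) (lam : nat -> R) (tau : R) (k : nat)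
    : R :=
  if 0 < lam k then s (tau + ln (lam k)) * lam k `^ p^-1 else 0.

Definition s_star (s : R -> R) (p : R) (lam : nat -> R) (tau : R) : R :=
  limn (series (s_star_term s p lam tau)).

End Asymptotics.

(* Main.v *)
(** The operator [T] is diagonalized by a maximal orthonormal family [e] of
    eigenvectors with positive eigenvalues [lam n]: off the eigenvectors with
    eigenvalue [>= eps], maximality forces the quadratic form of [T] below
    [eps], since a larger supremum would be attained at a further eigenvector.
    If [e'] and [mu] do the same for [T'], then the tensors of [e n] and [e' m]
    are orthonormal eigenvectors of [A] whose closed span contains the range of
    [A]; hence [A] is compact with positive eigenvalues [lam n * mu m], and
    [N(t, A) = \sum_m N(t / mu m, T)].

    Since [u `^ eps * phi u] is nondecreasing for large [u], one gets
    [N(t / mu m, T) <= C * mu m `^ q * phi (1 / t) * t `^ (- 1 / p)] for small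
    [t], uniformly in [m], for any fixed [q < 1 / p]. With [q > 1 / p'] the
    bound on [N(t, T')] makes [\sum_m mu m `^ q] finite, so that the termwise
    asymptotics can be summed by dominated convergence. *)
Require Import Defs.
From HB Require Import structures.
From mathcomp Require Import all_boot all_order all_algebra.
From mathcomp Require Import finmap sesquilinear complex ring lra.
From mathcomp Require Import all_classical all_reals all_analysis.

Set Implicit Arguments.
Unset Strict Implicit.
Unset Printing Implicit Defensive.

Import Order.TTheory GRing.Theory Num.Theory.
Import numFieldNormedType.Exports.

Local Open Scope classical_set_scope.
Local Open Scope ring_scope.

(** * Scalars of the base field *)

Section BaseField.
Variables (R : realType) (cplx : bool).
Local Notation K := (base_field R cplx).
Local Notation ofR := (@of_real R cplx).
Implicit Types (z w : K) (a b : R).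

(** The asymptotics of N(., T) says nothing about N(t / mu m, T) once mu m is comparable with t or
    smaller, and if T' has infinitely many positive eigenvalues this occurs for every t. There the
    bound comes from N(., T) vanishing above the top of the spectrum and being bounded away from
    zero; a single formula covers all ranges because the argument of the nondecreasing function phi
    u * u^eps is kept above a fixed [tau1]. The exponent splits as 1 / p = q + eps: the power q of
    mu m gives summability, while eps > 0 pays for the slow variation of phi. [eigval_seq] is only
    chosen from its specification, so counts are transferred by bijections between level sets: the
    dimension of an eigenspace is unique, hence every diagonalization gives the same count. For A
    this permits counting pairs of indices instead of sorting the products. Both base fields are
    treated at once by doing all estimates in [R], with the real part [rin] of the inner product and
    the real-valued norm [hn]. *)

Definition re : K -> R :=
  if cplx as b return base_field R b -> R then @complex.Re R else id.

Definition im : K -> R :=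
  if cplx as b return base_field R b -> R then @complex.Im R else fun=> 0.

Lemma of_real0 : ofR 0 = 0 :> K. Proof. by case: cplx. Qed.

Lemma of_real1 : ofR 1 = 1 :> K. Proof. by case: cplx. Qed.

Lemma of_realD a b : ofR (a + b) = ofR a + ofR b.
Proof. by case: cplx => //=; rewrite raddfD. Qed.

Lemma of_realN a : ofR (- a) = - ofR a.
Proof. by case: cplx => //=; rewrite raddfN. Qed.

Lemma of_realM a b : ofR (a * b) = ofR a * ofR b.
Proof. by case: cplx => //=; rewrite rmorphM. Qed.

Lemma le_of_real a b : (ofR a <= ofR b) = (a <= b).
Proof. by case: cplx => //=; rewrite lecR. Qed.

Lemma lt_of_real a b : (ofR a < ofR b) = (a < b).
Proof. by case: cplx => //=; rewrite ltcR. Qed.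

Lemma reD z w : re (z + w) = re z + re w.
Proof. by move: z w; rewrite /re; case: cplx => //= z w; rewrite raddfD. Qed.

Lemma imD z w : im (z + w) = im z + im w.
Proof.
by move: z w; rewrite /im; case: cplx => //= z w; rewrite ?raddfD// addr0.
Qed.

Lemma imN z : im (- z) = - im z.
Proof. by move: z; rewrite /im; case: cplx => //= z; rewrite ?raddfN// oppr0. Qed.

Lemma re_of_real a : re (ofR a) = a.
Proof. by rewrite /re; case: cplx. Qed.

Lemma re0 : re 0 = 0.
Proof. by rewrite -of_real0 re_of_real. Qed.

Lemma reN z : re (- z) = - re z.
Proof. by move: z; rewrite /re; case: cplx => //= z; rewrite raddfN. Qed.

Lemma reZ a z : re (ofR a * z) = a * re z.
Proof.
move: z; rewrite /re; case: cplx => //= -[x y] /=.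
by rewrite mul0r subr0.
Qed.

Lemma ge0_of_real z : 0 <= z -> z = ofR (re z).
Proof.
move: z; rewrite /re; case: cplx => //= -[x y] /=.
by rewrite lecE /= => /andP[/eqP -> _].
Qed.

Lemma re_ge0 z : 0 <= z -> 0 <= re z.
Proof. by move=> /[dup] /ge0_of_real {1}->; rewrite -of_real0 le_of_real. Qed.

Lemma sconjK z : sconj (sconj z) = z.
Proof. by move: z; rewrite /sconj; case: cplx => //= z; rewrite conjCK. Qed.

Lemma sconjM z w : sconj (z * w) = sconj z * sconj w.
Proof. by move: z w; rewrite /sconj; case: cplx => //= z w; rewrite rmorphM. Qed.

Lemma sconj_of_real a : sconj (ofR a) = ofR a.
Proof.
rewrite /sconj; case: cplx => //=; apply: CrealP.
by rewrite complex_real.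
Qed.

Lemma sconj0 : sconj (0 : K) = 0.
Proof. by rewrite -of_real0 sconj_of_real. Qed.

Lemma re_sconj z : re (sconj z) = re z.
Proof. by move: z; rewrite /sconj /re; case: cplx => //= -[x y]. Qed.

Lemma mul_sconj z : z * sconj z = `|z| ^+ 2.
Proof.
move: z; rewrite /sconj; case: cplx => //= z; first by rewrite normCK.
by rewrite -expr2 real_normK // num_real.
Qed.

Lemma mul_sconj_ge0 z : 0 <= z * sconj z.
Proof. by rewrite mul_sconj exprn_ge0. Qed.

Lemma re_mul_sconj z : re (z * sconj z) = re z ^+ 2 + im z ^+ 2.
Proof.
move: z; rewrite /sconj /re /im; case: cplx => //= [[x y]|z] /=.
  by rewrite mulrN opprK !expr2.
by rewrite expr0n addr0.
Qed.

Lemma sconj_id z : sconj z = z -> z = ofR (re z).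
Proof.
move: z; rewrite /sconj /re; case: cplx => //= -[x y] /= [yN].
by rewrite (_ : y = 0)//; lra.
Qed.

End BaseField.

(** The discriminant argument, isolated because it serves three forms: the inner product, the form
    of [T] and the form of [lam - T]. The last two may be degenerate, whence the case [c = 0]. *)
Lemma quadratic_ge0 (R : realFieldType) (a b c : R) : 0 <= c ->
  (forall t : R, 0 <= a + (t * b) *+ 2 + t ^+ 2 * c) -> b ^+ 2 <= a * c.
Proof.
rewrite le_eqVlt => /predU1P[<- h|c0 h].
  rewrite mulr0; case: (eqVneq b 0) => [->|b0]; first by rewrite expr0n.
  (* For [c = 0] the polynomial is affine in [t]; this [t] gives it the value -1. *)
  have := h (- (a + 1) / (2 * b)).
  have -> : a + (- (a + 1) / (2 * b) * b) *+ 2 +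
    (- (a + 1) / (2 * b)) ^+ 2 * 0 = -1 by field.
  by rewrite ler0N1.
(* The minimizer of the quadratic polynomial. *)
have := h (- b / c).
have -> : a + (- b / c * b) *+ 2 + (- b / c) ^+ 2 * c = (a * c - b ^+ 2) / c.
  by field; rewrite gt_eqF.
by rewrite pmulr_lge0 ?invr_gt0// subr_ge0.
Qed.

(** * Inner products, closed subspaces and closed spans *)

Section Inner.
Variables (R : realType) (cplx : bool) (H : hilbert R cplx).
Local Notation K := (base_field R cplx).
Local Notation ofR := (@of_real R cplx).
Implicit Types (x y z : H) (c : K) (a : R).

Lemma innerDl x y z : inner H (x + y) z = inner H x z + inner H y z.
Proof. exact: linearDl. Qed.

Lemma innerDr x y z : inner H x (y + z) = inner H x y + inner H x z.
Proof. exact: linearDr. Qed.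

Lemma innerNl x y : inner H (- x) y = - inner H x y.
Proof. exact: linearNl. Qed.

Lemma inner0l y : inner H 0 y = 0.
Proof. exact: linear0l. Qed.

Lemma innerZl c x y : inner H (c *: x) y = c * inner H x y.
Proof. exact: linearZl_LR. Qed.

Lemma innerZr c x y : inner H x (c *: y) = sconj c * inner H x y.
Proof. exact: linearZr. Qed.

Lemma innerC x y : inner H x y = sconj (inner H y x).
Proof. by rewrite (hermitian_subproof x y) expr0 mul1r. Qed.

Lemma inner_eq0C x y : inner H x y = 0 -> inner H y x = 0.
Proof. by rewrite innerC => xy0; rewrite -[RHS](sconj0 R cplx) -xy0 sconjK. Qed.

Lemma inner_suml (J : Type) (s : seq J) (P : pred J) (F : J -> H) y :
  inner H (\sum_(j <- s | P j) F j) y = \sum_(j <- s | P j) inner H (F j) y.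
Proof.
elim/big_ind2: _ => [|u a v b <- <-|//]; first exact: inner0l.
exact: innerDl.
Qed.

Definition rin x y : R := re (inner H x y).

Lemma rinC x y : rin x y = rin y x.
Proof. by rewrite /rin innerC re_sconj. Qed.

Lemma rinDl x y z : rin (x + y) z = rin x z + rin y z.
Proof. by rewrite /rin innerDl reD. Qed.

Lemma rinDr x y z : rin x (y + z) = rin x y + rin x z.
Proof. by rewrite /rin innerDr reD. Qed.

Lemma rinZl a x y : rin (ofR a *: x) y = a * rin x y.
Proof. by rewrite /rin innerZl reZ. Qed.

Lemma rinZr a x y : rin x (ofR a *: y) = a * rin x y.
Proof. by rewrite rinC rinZl rinC. Qed.

Lemma scale_ofRN1 x : ofR (-1) *: x = - x.
Proof. by rewrite of_realN of_real1 scaleN1r. Qed.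

Lemma rinNl x y : rin (- x) y = - rin x y.
Proof. by rewrite -scale_ofRN1 rinZl mulN1r. Qed.

Lemma rinNr x y : rin x (- y) = - rin x y.
Proof. by rewrite rinC rinNl rinC. Qed.

Lemma rinBl x y z : rin (x - y) z = rin x z - rin y z.
Proof. by rewrite rinDl rinNl. Qed.

Lemma rin0l y : rin 0 y = 0.
Proof. by rewrite /rin inner0l re0. Qed.

Lemma inner_xx x : inner H x x = ofR (rin x x).
Proof. by apply: ge0_of_real; rewrite inner_norm exprn_ge0. Qed.

Lemma rin_ge0 x : 0 <= rin x x.
Proof. by apply: re_ge0; rewrite inner_norm exprn_ge0. Qed.

Lemma rin_eq0 x : rin x x = 0 -> x = 0.
Proof.
move=> x0; apply/eqP; rewrite -normr_eq0 -sqrf_eq0 -inner_norm inner_xx x0.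
by rewrite of_real0.
Qed.

Lemma rin_gt0 x : x != 0 -> 0 < rin x x.
Proof. by move=> /eqP x0; rewrite lt0r rin_ge0 andbT; apply/eqP => /rin_eq0. Qed.

Definition hn x : R := Num.sqrt (rin x x).

Lemma hn_ge0 x : 0 <= hn x. Proof. exact: sqrtr_ge0. Qed.

Lemma sqr_hn x : hn x ^+ 2 = rin x x.
Proof. by rewrite sqr_sqrtr// rin_ge0. Qed.

Lemma normE x : `|x| = ofR (hn x).
Proof.
apply/eqP; rewrite -(@eqrXn2 _ 2)//; last first.
  by rewrite -(of_real0 R cplx) le_of_real hn_ge0.
by rewrite -inner_norm inner_xx -sqr_hn !expr2 of_realM.
Qed.

Lemma hn0 : hn 0 = 0. Proof. by rewrite /hn rin0l sqrtr0. Qed.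

Lemma hn_eq0 x : hn x = 0 -> x = 0.
Proof. by move=> x0; apply: rin_eq0; rewrite -sqr_hn x0 expr0n. Qed.

Lemma hnD x y : hn (x + y) <= hn x + hn y.
Proof. by rewrite -(le_of_real cplx) of_realD -!normE ler_normD. Qed.

Lemma hnN x : hn (- x) = hn x.
Proof. by rewrite /hn rinNl rinNr opprK. Qed.

Lemma hnC x y : hn (x - y) = hn (y - x).
Proof. by rewrite -hnN opprB. Qed.

Lemma hnB x y : hn (x - y) <= hn x + hn y.
Proof. by rewrite -(hnN y) hnD. Qed.

Lemma hn_tri z x y : hn (x - y) <= hn (x - z) + hn (z - y).
Proof. by rewrite -(subrKA z) hnD. Qed.

Lemma hnZ c x : hn (c *: x) = re `|c| * hn x.
Proof.
have := normrZ c x; rewrite !normE [in RHS](ge0_of_real (normr_ge0 c)).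
by rewrite -of_realM => /(congr1 (@re R cplx)); rewrite !re_of_real.
Qed.

Lemma hnZr a x : hn (ofR a *: x) = `|a| * hn x.
Proof.
by rewrite /hn rinZl rinZr mulrA -expr2 sqrtrM ?sqr_ge0// sqrtr_sqr.
Qed.

Lemma hn_le a x : 0 <= a -> (hn x <= a) = (rin x x <= a ^+ 2).
Proof. by move=> a0; rewrite -sqr_hn ler_pXn2r ?nnegrE ?hn_ge0. Qed.

Lemma rin_le x y : `|rin x y| <= hn x * hn y.
Proof.
rewrite -(@ler_pXn2r _ 2) ?nnegrE ?mulr_ge0 ?hn_ge0 ?normr_ge0//.
rewrite real_normK ?num_real// exprMn !sqr_hn.
apply: quadratic_ge0 => [|t]; first exact: rin_ge0.
have := rin_ge0 (x + ofR t *: y).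
rewrite rinDl !rinDr rinZl !rinZr rinZl (rinC y x).
by congr (0 <= _); ring.
Qed.

Definition csubspace (N : set H) :=
  [/\ N 0, forall x y, N x -> N y -> N (x + y), forall c x, N x -> N (c *: x) &
      forall x, (forall d, 0 < d -> exists2 v, N v & hn (x - v) <= d) -> N x].

(* Stated by quantifying over closed subspaces, so that membership is transported
   through [tens] and through bounded operators by taking preimages. *)
Definition cspan (W : set H) : set H :=
  [set x | forall N, csubspace N -> W `<=` N -> N x].

(** The modulus is recovered from real parts by rotating [y]: with [z = inner H x y], the real part
    of the product of [x] and [z *: y] is the square of the modulus of [z]. *)
Lemma re_norm_inner_le x y : re `|inner H x y| <= hn x * hn y.
Proof.
set z := inner H x y.
have z0 : 0 <= re `|z| by rewrite re_ge0.
have [->|zn0] := eqVneq (re `|z|) 0; first by rewrite mulr_ge0 ?hn_ge0.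
rewrite -(@ler_pM2r _ (re `|z|)); last by rewrite lt0r zn0.
have -> : re `|z| * re `|z| = rin x (z *: y).
  rewrite /rin innerZr -/z [sconj z * z]mulrC mul_sconj [in RHS](ge0_of_real (normr_ge0 z)).
  by rewrite expr2 reZ re_of_real.
by rewrite (le_trans (ler_norm _))// (le_trans (rin_le _ _))// hnZ mulrCA mulrC.
Qed.

Lemma csubspace_ker (f : H -> K) C : 0 < C ->
  (forall x y, f (x + y) = f x + f y) -> (forall c x, f (c *: x) = c * f x) ->
  (forall x, re `|f x| <= C * hn x) -> csubspace [set x | f x = 0].
Proof.
move=> C0 fD fZ fC; split=> [|x y /= fx fy|c x /= fx|x hx] /=.
- by rewrite -(scale0r 0) fZ mul0r.
- by rewrite fD fx fy addr0.
- by rewrite fZ fx mulr0.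
apply/eqP; rewrite -normr_eq0 [X in X == 0](ge0_of_real (normr_ge0 _)).
suff -> : re `|f x| = 0 by rewrite of_real0.
apply/eqP; rewrite eq_le re_ge0// andbT; apply/ler_addgt0Pl => d d0; rewrite addr0.
have [v fv hv] := hx _ (divr_gt0 d0 C0).
have -> : f x = f (x - v) by rewrite -scaleN1r fD fZ fv mulr0 addr0.
by rewrite (le_trans (fC _))// -ler_pdivlMl// mulrC.
Qed.

Lemma csubspace_bigcap (J : Type) (V : set J) (N : J -> set H) :
  (forall j, csubspace (N j)) -> csubspace (\bigcap_(j in V) N j).
Proof.
move=> Nsub; split=> [j _|x y hx hy j Vj|c x hx j Vj|x hx j Vj].
- by have [] := Nsub j.
- by have [_ ND _ _] := Nsub j; apply: ND; [exact: hx|exact: hy].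
- by have [_ _ NZ _] := Nsub j; apply: NZ; exact: hx.
- have [_ _ _ Ncl] := Nsub j; apply: Ncl => d /hx[v hv xv].
  by exists v => //; exact: hv.
Qed.

Lemma csubspace_orth (V : set H) :
  csubspace [set x | forall v, V v -> inner H x v = 0].
Proof.
apply: (@csubspace_bigcap _ V (fun v => [set x | inner H x v = 0])) => v.
(* The summand 1 keeps the constant positive when [v = 0]; the same device recurs below. *)
have hv : 0 < hn v + 1 by rewrite ltr_wpDl// hn_ge0.
apply: (csubspace_ker hv) => [x y|c x|x]; first exact: innerDl.
  exact: innerZl.
by rewrite (le_trans (re_norm_inner_le _ _))// mulrC ler_wpM2r ?hn_ge0// lerDl.
Qed.

Lemma cspan_orth (W : set H) x y :
  (forall w, W w -> inner H w y = 0) -> cspan W x -> inner H x y = 0.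
Proof.
move=> hW /(_ _ (csubspace_orth [set y])); apply=> //.
by move=> w Ww /= v ->; exact: hW.
Qed.

Lemma dense_cspan (W : set H) : dense W -> forall x, cspan W x.
Proof.
move=> dW x N [_ _ _ Ncl] WN; apply: Ncl => d d0.
have d0' : 0 < ofR d by rewrite -(of_real0 R cplx) lt_of_real.
have [z [/= hz Wz]] : ball x (ofR d) `&` W !=set0.
  by apply: dW; [exists x; exact: ballxx|exact: ball_open].
exists z; first exact: WN.
by rewrite -(le_of_real cplx) -normE; move: hz; rewrite -ball_normE /= => /ltW.
Qed.

End Inner.

(** * Finite orthogonal projections onto an orthonormal family *)

Section Orthonormal.
Variables (R : realType) (cplx : bool) (H : hilbert R cplx).
Variables (I : choiceType) (D : set I) (e : I -> H).
Local Notation K := (base_field R cplx).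
Local Notation ofR := (@of_real R cplx).
Implicit Types (x y z : H) (c : K) (a : R) (A B : {fset I}).

Definition ortho_family :=
  forall i j, D i -> D j -> inner H (e i) (e j) = (i == j)%:R.

Definition proj A x := \sum_(i <- A) inner H x (e i) *: e i.

Definition perp A x := x - proj A x.

Lemma projD A x y : proj A (x + y) = proj A x + proj A y.
Proof.
by rewrite -big_split; apply: eq_bigr => i _; rewrite innerDl scalerDl.
Qed.

Lemma projZ A c x : proj A (c *: x) = c *: proj A x.
Proof. by rewrite scaler_sumr; apply: eq_bigr => i _; rewrite innerZl scalerA. Qed.

Lemma perpD A x y : perp A (x + y) = perp A x + perp A y.
Proof. by rewrite /perp projD opprD addrACA. Qed.

Lemma perpZ A c x : perp A (c *: x) = c *: perp A x.
Proof. by rewrite /perp projZ scalerBr. Qed.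

Lemma perpB A x y : perp A (x - y) = perp A x - perp A y.
Proof. by rewrite perpD -scaleN1r perpZ scaleN1r. Qed.

Hypothesis eD : ortho_family.

Lemma inner_sume A (c : I -> K) j : [set` A] `<=` D -> D j ->
  inner H (\sum_(i <- A) c i *: e i) (e j) = if j \in A then c j else 0.
Proof.
move=> AD Dj; rewrite inner_suml big_seq.
have -> : \sum_(i <- A | i \in A) inner H (c i *: e i) (e j) =
    \sum_(i <- A | i \in A) c i * (i == j)%:R.
  by apply: eq_bigr => i iA; rewrite innerZl eD//; exact: AD.
rewrite -big_seq; case: ifP => jA.
  rewrite (big_fsetD1 j)//= eqxx mulr1 big_seq big1 ?addr0// => i.
  by rewrite !inE => /andP[/negPf-> _]; rewrite mulr0.
rewrite big_seq big1// => i iA; case: eqP => [ij|_]; last by rewrite mulr0.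
by rewrite -ij iA in jA.
Qed.

Lemma inner_perp A x j : [set` A] `<=` D -> D j ->
  inner H (perp A x) (e j) = if j \in A then 0 else inner H x (e j).
Proof.
move=> AD Dj; rewrite /perp innerDl innerNl inner_sume//.
by case: ifP; rewrite ?subrr ?subr0.
Qed.

Lemma inner_sum_orth A (c : I -> K) y :
  (forall i, i \in A -> inner H (e i) y = 0) ->
  inner H (\sum_(i <- A) c i *: e i) y = 0.
Proof.
move=> h; rewrite inner_suml big_seq big1// => i iA.
by rewrite innerZl h// mulr0.
Qed.

Lemma rin_proj_perp A x y : [set` A] `<=` D -> rin (proj A y) (perp A x) = 0.
Proof.
move=> AD; rewrite /rin inner_sum_orth.
  by rewrite re0.
move=> i iA; apply: inner_eq0C; rewrite inner_perp ?iA//.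
exact: AD.
Qed.

Lemma pythagoras A x : [set` A] `<=` D ->
  rin x x = rin (proj A x) (proj A x) + rin (perp A x) (perp A x).
Proof.
move=> AD; have {1 2}-> : x = proj A x + perp A x by rewrite subrKC.
set u := proj A x; set v := perp A x.
have uv : rin u v = 0 by exact: rin_proj_perp.
by rewrite rinDl (rinDr u u) (rinDr v u) (rinC v u) uv addr0 add0r.
Qed.

Lemma hn_perp A x : [set` A] `<=` D -> hn (perp A x) <= hn x.
Proof.
move=> AD; rewrite hn_le ?hn_ge0// sqr_hn (@pythagoras A x)//.
by rewrite lerDr rin_ge0.
Qed.

Lemma rin_sume A (c : I -> K) : [set` A] `<=` D ->
  rin (\sum_(i <- A) c i *: e i) (\sum_(i <- A) c i *: e i) =
  \sum_(i <- A) re (c i * sconj (c i)).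
Proof.
move=> AD; rewrite /rin inner_suml.
have -> : \sum_(j <- A) inner H (c j *: e j) (\sum_(i <- A) c i *: e i)
   = \sum_(j <- A) c j * sconj (c j).
  rewrite big_seq [RHS]big_seq; apply: eq_bigr => j jA.
  by rewrite innerZl innerC inner_sume ?jA//; exact: AD.
elim/big_ind2: _ => [|u a v b <- <-|//]; last by rewrite reD.
by rewrite re0.
Qed.

Lemma bessel A x : [set` A] `<=` D ->
  \sum_(i <- A) re (inner H x (e i) * sconj (inner H x (e i))) <= rin x x.
Proof.
move=> AD; rewrite -(rin_sume (fun i => inner H x (e i)) AD) (@pythagoras A x)//.
by rewrite lerDl rin_ge0.
Qed.

(** Together with [hn_perp] this shows that residuals only shrink when the finite set grows, so that
    approximations with different sets can be merged over their union. *)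
Lemma perp_perp A B x : [set` A] `<=` D -> [set` B] `<=` D -> (B `<=` A)%fset ->
  perp A (perp B x) = perp A x.
Proof.
move=> AD BD BA; rewrite {2}/perp perpB -[RHS]subr0; congr (_ - _).
(* [z] is what [A] leaves of [proj B x]. It is orthogonal to every [e i] with [i] in [A], hence to
   [proj B x], and so to itself. *)
apply/rin_eq0; set z := perp A _.
have -> : rin z z = rin (proj B x) z - rin (proj A (proj B x)) z.
  by rewrite -rinBl.
rewrite rin_proj_perp// subr0 /rin inner_sum_orth => [|i iB].
  by rewrite re0.
by apply: inner_eq0C; rewrite inner_perp ?(fsubsetP BA)//; exact: BD.
Qed.

(** The vectors with arbitrarily small residuals form a closed subspace containing the family, so
    they contain its closed span. *)
Lemma cspan_approx x : cspan (e @` D) x -> forall d, 0 < d ->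
  exists2 A : {fset I}, [set` A] `<=` D & hn (perp A x) <= d.
Proof.
move=> /(_ [set x | forall d, 0 < d ->
  exists2 A : {fset I}, [set` A] `<=` D & hn (perp A x) <= d]); apply; last first.
  move=> _ [i Di <-] d d0; exists [fset i]%fset.
    by move=> j /=; rewrite inE => /eqP->.
  by rewrite /perp /proj big_seq_fset1 eD// eqxx scale1r subrr hn0 ltW.
split => [d d0|{}x y hx hy d d0|c {}x hx d d0|{}x hx d d0].
- by exists fset0; [move=> j /=; rewrite inE|rewrite /perp /proj big_seq_fset0 subr0 hn0 ltW].
- have d20 : 0 < d / 2 by rewrite divr_gt0.
  have [[A AD hA] [B BD hB]] := (hx _ d20, hy _ d20).
  have ABD : [set` (A `|` B)%fset] `<=` D.
    by move=> j /=; rewrite inE => /orP[]; [exact: AD|exact: BD].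
  exists (A `|` B)%fset => //; rewrite perpD (le_trans (hnD _ _))// (splitr d).
  rewrite -(@perp_perp _ A)// ?fsubsetUl// -(@perp_perp _ B y)// ?fsubsetUr//.
  by apply: lerD; rewrite (le_trans (hn_perp _ _)).
- have c0 : 0 < re `|c| + 1 by rewrite ltr_wpDl// re_ge0.
  have [A AD hA] := hx _ (divr_gt0 d0 c0); exists A => //.
  rewrite perpZ hnZ (le_trans (y := (re `|c| + 1) * (d / (re `|c| + 1))))//.
    by rewrite ler_pM// ?hn_ge0 ?re_ge0// lerDl.
  by rewrite mulrC mulfVK// gt_eqF.
have d20 : 0 < d / 2 by rewrite divr_gt0.
have [v /(_ _ d20)[A AD hA] hv] := hx _ d20; exists A => //.
rewrite -(subrK v x) perpD (le_trans (hnD _ _))// (splitr d) lerD//.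
by rewrite (le_trans (hn_perp _ _)).
Qed.

End Orthonormal.

(** * Nonnegative self-adjoint operators *)

Section Operator.
Variables (R : realType) (cplx : bool) (H : hilbert R cplx).
Variable T : {linear H -> H}.
Local Notation K := (base_field R cplx).
Local Notation ofR := (@of_real R cplx).
Implicit Types (x y z : H) (c : K) (a : R).

Definition bounded_op := exists2 C : R, 0 < C & forall x, hn (T x) <= C * hn x.

Lemma opD x y : T (x + y) = T x + T y. Proof. exact: raddfD. Qed.

Lemma opB x y : T (x - y) = T x - T y. Proof. exact: raddfB. Qed.

Lemma opZ c x : T (c *: x) = c *: T x. Proof. exact: linearZ. Qed.

Lemma continuous_bounded_op : continuous T -> bounded_op.
Proof.
move=> /(_ 0) T0.
have e1 : 0 < ofR 1 by rewrite of_real1.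
have : nbhs (T 0) (ball (T 0) (ofR 1)) by exact: nbhsx_ballx.
move=> /T0 /nbhs_ballP[d /= d0]; rewrite raddf0 => hd.
have [d' d'0 dE] : exists2 d' : R, 0 < d' & d = ofR d'.
  exists (re d); last by rewrite -ge0_of_real// ltW.
  by rewrite -(lt_of_real cplx) of_real0 -ge0_of_real// ltW.
have {}hd x : hn x < d' -> hn (T x) < 1.
  move=> xd; have /hd : ball 0 d x.
    by rewrite -ball_normE /= sub0r normrN normE dE lt_of_real.
  by rewrite /= -ball_normE /= sub0r normrN normE lt_of_real.
exists (2 / d') => [|x]; first by rewrite divr_gt0.
have [->|/eqP x0] := eqVneq x 0; first by rewrite raddf0 !hn0 mulr0.
have hx : 0 < hn x.
  by rewrite lt0r hn_ge0 andbT; apply/eqP => /hn_eq0.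
have := hd (ofR (d' / (2 * hn x)) *: x).
rewrite opZ !hnZr ger0_norm; last by rewrite divr_ge0 ?mulr_ge0 ?hn_ge0 ?ltW.
have -> : d' / (2 * hn x) * hn x = d' / 2 by field; rewrite gt_eqF.
rewrite ltr_pdivrMr// ltr_pMr// ltr1n => /(_ isT).
rewrite mulrAC ltr_pdivrMr ?mulr_gt0// mul1r => /ltW.
by rewrite mulrAC ler_pdivlMr// mulrC.
Qed.

(** Sequential compactness in cluster-point form: arbitrarily late terms come close to [y], and no
    subsequence has to be extracted. *)
Lemma compact_cluster (x_ : nat -> H) : compact_operator T ->
  (forall n, hn (x_ n) <= 1) ->
  exists y, forall d N, 0 < d -> exists2 n, (N <= n)%N & hn (T (x_ n) - y) < d.
Proof.
rewrite /compact_operator precompactE => cT x1.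
have [|y [_ yc]] := cT ((T \o x_) @ \oo) _.
  exists 0%N => // n _ /=; apply: subset_closure; exists (x_ n) => //=.
  by rewrite normE -(of_real1 R cplx) le_of_real.
exists y => d N d0.
have [] := yc [set T (x_ n) | n in [set n | (N <= n)%N]] (ball y (ofR d)).
- by exists N => // n /= Nn; exists n.
- by apply: nbhsx_ballx; rewrite -(of_real0 R cplx) lt_of_real.
move=> _ [[n /= Nn <-]]; rewrite -ball_normE /= normE lt_of_real hnC => h.
by exists n.
Qed.

Lemma compact_bounded_op : compact_operator T -> bounded_op.
Proof.
move=> cT; apply: contrapT => nb.
have ex (n : nat) : exists x, hn x <= 1 /\ n%:R <= hn (T x).
  apply: contrapT => /forallNP h; apply: nb; exists n.+1%:R => // x.
  have [->|/eqP x0] := eqVneq x 0; first by rewrite raddf0 !hn0 mulr0.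
  have hx : 0 < hn x by rewrite lt0r hn_ge0 andbT; apply/eqP => /hn_eq0.
  have := h (ofR (hn x)^-1 *: x).
  rewrite opZ !hnZr ger0_norm ?invr_ge0 ?hn_ge0// mulVf ?gt_eqF//.
  rewrite not_andP => -[//|/negP]; rewrite -ltNge mulrC ltr_pdivrMr// => /ltW.
  by move=> /le_trans; apply; rewrite ler_pM2r// ler_nat.
have [x_ x_P] := choice ex.
have [|y hy] := @compact_cluster x_ cT; first by move=> n; have [] := x_P n.
(* An index beyond [hn y + 1]: there [T (x_ n)] is within 1 of [y], yet its norm is at least [n]. *)
have [n Nn h] := hy 1 (Num.truncn (hn y + 1)).+1 ltr01.
have [_ hn1] := x_P n.
have : hn (T (x_ n)) < hn y + 1.
  rewrite -(subrK y (T (x_ n))) (le_lt_trans (hnD _ _))// addrC ltrD2l//.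
apply/negP; rewrite -leNgt (le_trans _ hn1)// ltW//.
rewrite (lt_le_trans (truncnS_gt _))// ler_nat//.
Qed.

Section SelfAdjoint.
Hypothesis saT : self_adjoint T.

Lemma rin_sa x y : rin (T x) y = rin x (T y).
Proof. by rewrite /rin saT. Qed.

Lemma orth_eigenvec x y a b : T x = ofR a *: x -> T y = ofR b *: y -> a != b ->
  inner H x y = 0.
Proof.
move=> xa yb ab; have := saT x y; rewrite xa yb innerZl innerZr sconj_of_real.
move=> /eqP; rewrite -subr_eq0 -mulrBl mulf_eq0 => /orP[|/eqP//].
by rewrite -of_realN -of_realD -(of_real0 R cplx) eq_le !le_of_real -eq_le subr_eq0 (negPf ab).
Qed.

Lemma invariant_orth (V : set H) (l : H -> R) x :
  (forall v, V v -> T v = ofR (l v) *: v) ->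
  (forall v, V v -> inner H x v = 0) -> forall v, V v -> inner H (T x) v = 0.
Proof.
move=> Tv xV v Vv; rewrite saT Tv// innerZr xV// mulr0 //.
Qed.

End SelfAdjoint.

Section NonnegSA.
Hypothesis saT : self_adjoint T.
Hypothesis T0 : nonnegative T.

Lemma rin_op_ge0 x : 0 <= rin (T x) x.
Proof. exact/re_ge0/T0. Qed.

Lemma op_cauchy_schwarz x y :
  rin (T x) y ^+ 2 <= rin (T x) x * rin (T y) y.
Proof.
apply: quadratic_ge0 => [|t]; first exact: rin_op_ge0.
have := rin_op_ge0 (x + ofR t *: y).
rewrite opD opZ rinDl !rinDr rinZl !rinZr rinZl (rin_sa saT y x) (rinC y).
by congr (0 <= _); ring.
Qed.

(** Cauchy-Schwarz for the form of [T] at [x] and [T x] bounds the fourth power of [hn (T x)] by the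
    product of the forms at [x] and at [T x]; invariance of [M] lets the hypothesis be used at
    both. *)
Lemma op_form_bound (M : set H) eps : 0 <= eps -> (forall x, M x -> M (T x)) ->
  (forall x, M x -> rin (T x) x <= eps * rin x x) ->
  forall x, M x -> hn (T x) <= eps * hn x.
Proof.
move=> eps0 MT Me x Mx; rewrite hn_le ?mulr_ge0 ?hn_ge0// exprMn sqr_hn.
have [->|TT0] := eqVneq (rin (T x) (T x)) 0.
  by rewrite mulr_ge0 ?sqr_ge0 ?rin_ge0.
have TTp : 0 < rin (T x) (T x) by rewrite lt0r TT0 rin_ge0.
rewrite -(ler_pM2r TTp) -expr2.
rewrite (le_trans (op_cauchy_schwarz _ _))//.
have -> : eps ^+ 2 * rin x x * rin (T x) (T x) =
  (eps * rin x x) * (eps * rin (T x) (T x)) by ring.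
by apply: ler_pM; rewrite ?rin_op_ge0// Me//; exact: MT.
Qed.

(* Along a maximizing sequence [x_ n] of the form on the unit ball of [M], with
   supremum [lam], Cauchy-Schwarz for the nonnegative form of [lam - T] gives
   [T (x_ n) - lam x_ n --> 0]; a cluster point of [T (x_ n)] is an eigenvector. *)
Lemma exists_eigenvector (M : set H) eps x0 :
  compact_operator T -> csubspace M -> (forall x, M x -> M (T x)) -> 0 < eps ->
  M x0 -> eps * rin x0 x0 < rin (T x0) x0 ->
  exists lam y, [/\ eps < lam, M y, y != 0 & T y = ofR lam *: y].
Proof.
move=> cT [M0 MD MZ Mcl] MT eps0 Mx0 hx0.
have [C C0 TC] := compact_bounded_op cT.
pose S := [set rin (T x) x | x in [set x | M x /\ hn x <= 1]].
have S_ub : ubound S C.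
  move=> _ [x [Mx x1] <-]; rewrite (le_trans (ler_norm _))//.
  rewrite (le_trans (rin_le _ _))// (le_trans (ler_wpM2r (hn_ge0 _) (TC x)))//.
  rewrite -mulrA ger_pMr// -expr2 expr_le1// hn_ge0//.
have S_sup : has_sup S.
  split; last by exists C.
  by exists (rin (T 0) 0); exists 0 => //; split; rewrite ?hn0.
pose lam := sup S.
have normalized x : M x -> x != 0 ->
    S ((hn x)^-1 ^+ 2 * rin (T x) x) /\ 0 < hn x.
  move=> Mx /eqP xn0.
  have hx : 0 < hn x by rewrite lt0r hn_ge0 andbT; apply/eqP => /hn_eq0.
  split=> //; exists (ofR (hn x)^-1 *: x).
    split; first exact: MZ.
    by rewrite hnZr ger0_norm ?invr_ge0 ?hn_ge0// mulVf ?gt_eqF.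
  by rewrite opZ rinZl rinZr mulrA.
have lamP x : M x -> rin (T x) x <= lam * rin x x.
  move=> Mx; have [->|xn0] := eqVneq x 0.
    by rewrite raddf0 !rin0l mulr0.
  have [Sx hx] := normalized x Mx xn0.
  have := ub_le_sup S_sup.2 Sx.
  by rewrite -/lam mulrC exprVn ler_pdivrMr ?exprn_gt0// sqr_hn.
have elam : eps < lam.
  have x0n0 : x0 != 0.
    by apply/eqP => x00; move: hx0; rewrite x00 raddf0 !rin0l mulr0 ltxx.
  have := lt_le_trans hx0 (lamP _ Mx0).
  by rewrite ltr_pM2r// rin_gt0.
have lam0 : 0 < lam by exact: lt_trans elam.
have ex (n : nat) : exists x, [/\ M x, hn x <= 1 & lam - n.+1%:R^-1 < rin (T x) x].
  have n0 : 0 < n.+1%:R^-1 :> R by rewrite invr_gt0.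
  have [_ [x [Mx x1] <-] h] := sup_adherent n0 S_sup.
  by exists x.
have [x_ x_P] := choice ex.
have [|y hy] := @compact_cluster x_ cT; first by move=> n; have [] := x_P n.
have {}hy d : 0 < d -> exists x, [/\ M x, hn x <= 1, lam - d < rin (T x) x &
    hn (T x - y) < d].
  move=> d0; have [n Nn h] := hy d (Num.truncn d^-1) d0.
  have [Mx x1 hx] := x_P n; exists (x_ n); split=> //.
  rewrite (le_lt_trans _ hx)// lerD2l lerN2 -[leRHS]invrK lef_pV2 ?posrE ?invr_gt0//.
  by rewrite (le_trans (ltW (truncnS_gt _)))// ler_nat.
have residual d x : M x -> hn x <= 1 -> lam - d < rin (T x) x ->
    rin (ofR lam *: x - T x) (ofR lam *: x - T x) <= lam * d.
  move=> Mx x1 hx; have [w wE] : exists w, w = ofR lam *: x - T x by exists (ofR lam *: x - T x).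
  rewrite -wE.
  have Mw : M w.
    rewrite wE; apply: MD; first exact: MZ.
    by rewrite -scaleN1r; apply: MZ; exact: MT.
  pose B u v := lam * rin u v - rin (T u) v.
  have BC : B x w ^+ 2 <= B x x * B w w.
    apply: quadratic_ge0 => [|t]; first by rewrite subr_ge0 lamP.
    have Mt : M (x + ofR t *: w) by apply: MD => //; exact: MZ.
    have := lamP _ Mt; rewrite -subr_ge0.
    rewrite opD opZ !rinDl !rinDr !rinZl !rinZr.
    rewrite (rin_sa saT w x) (rinC w (T x)) (rinC w x) /B.
    by congr (0 <= _); ring.
  have Bxw : B x w = rin w w by rewrite /B -rinZl -rinBl -wE.
  have Bww : B w w <= lam * rin w w by rewrite /B gerBl rin_op_ge0.
  have Bxx : B x x <= d.
    rewrite /B lerBlDr (le_trans (y := lam))//.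
      by rewrite ger_pMr// -sqr_hn expr_le1// hn_ge0.
    by rewrite addrC -lerBlDr ltW.
  have B0 : 0 <= B x x by rewrite subr_ge0 lamP.
  have [->|w0] := eqVneq w 0.
    by rewrite rin0l; exact: mulr_ge0 (ltW lam0) (le_trans B0 Bxx).
  rewrite -(ler_pM2r (rin_gt0 w0)) -expr2 -Bxw (le_trans BC)// Bxw.
  rewrite mulrAC mulrC; apply: ler_pM => //.
  by rewrite subr_ge0 lamP.
exists lam, y; split=> //.
- apply: Mcl => d d0; have [x [Mx _ _ h]] := hy d d0.
  by exists (T x); [exact: MT|rewrite hnC ltW].
(* If [y = 0], some [x] of the unit ball has [hn (T x) < lam / 2], although its form exceeds
   [lam / 2]. *)
- apply/eqP => y0; have l20 : 0 < lam / 2 by rewrite divr_gt0.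
  have [x [Mx x1 h]] := hy _ l20; rewrite y0 subr0 => h'.
  have := le_trans (ler_norm _) (rin_le (T x) x).
  have : hn (T x) * hn x <= hn (T x) by rewrite ler_piMr ?hn_ge0.
  by move: h h'; lra.
apply/eqP; rewrite -subr_eq0; apply/eqP/hn_eq0/eqP.
rewrite eq_le hn_ge0 andbT; apply/ler_addgt0Pl => eta' eta'0; rewrite addr0.
pose k := 2 * C + lam.
have k0 : 0 < k by rewrite addr_gt0// mulr_gt0.
pose eta := eta' / k.
have eta0 : 0 < eta by rewrite divr_gt0.
have etaE : eta' = k * eta by rewrite mulrC mulfVK ?gt_eqF.
(* The second argument turns the bound [lam * d] of [residual] into [eta ^+ 2]. The three terms of
   the decomposition below then cost [C * eta], [C * eta] and [lam * eta], which explains [k]. *)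
have d0 : 0 < Num.min eta (eta ^+ 2 / lam).
  by rewrite lt_min eta0 divr_gt0 ?exprn_gt0.
have [x [Mx x1 h h']] := hy _ d0.
have h1 : hn (T x - y) <= eta by rewrite (le_trans (ltW h'))// ge_min lexx.
have h2 : hn (ofR lam *: x - T x) <= eta.
  rewrite (hn_le _ (ltW eta0)) (le_trans (residual _ _ Mx x1 h))//.
  by rewrite mulrC -ler_pdivlMr// ge_min lexx orbT.
have -> : T y - ofR lam *: y =
    T (y - T x) - T (ofR lam *: x - T x) + ofR lam *: (T x - y).
  by rewrite !opB opZ scalerBr opprB !subrKA.
have -> : eta' = C * eta + C * eta + lam * eta by rewrite etaE /k; ring.
rewrite (le_trans (hnD _ _))// lerD//; last first.
  by rewrite hnZr (ger0_norm (ltW lam0)) ler_pM2l.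
rewrite (le_trans (hnB _ _))// lerD// (le_trans (TC _))// ler_pM2l//.
by rewrite hnC.
Qed.

End NonnegSA.
End Operator.

(** * Diagonalization *)

Section Diagonal.
Variables (R : realType) (cplx : bool) (H : hilbert R cplx).
Variable T : {linear H -> H}.
Local Notation K := (base_field R cplx).
Local Notation ofR := (@of_real R cplx).

(** Completeness is asked on the range of [T] only, since its kernel carries no positive eigenvalue.
    The index type is free: vectors for Zorn's lemma, naturals for a sorted list, pairs for a tensor
    product. *)
Definition diagonalizes (I : choiceType) (D : set I) (e : I -> H) (l : I -> R) :=
  [/\ ortho_family D e,
      forall i, D i -> 0 < l i /\ T (e i) = ofR (l i) *: e i,
      forall t, 0 < t -> finite_set [set i | D i /\ t <= l i] &
      forall x, cspan (e @` D) (T x)].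

(** Infinitely many orthonormal eigenvectors with eigenvalues at least [t] would have images that
    stay apart: the difference of two images, tested against the first vector, is at least [t]. This
    excludes a cluster point. *)
Lemma eigenvalues_finite (I : pointedType) (D : set I) (e : I -> H) (l : I -> R) t :
  compact_operator T -> ortho_family D e ->
  (forall i, D i -> T (e i) = ofR (l i) *: e i) -> 0 < t ->
  finite_set [set i | D i /\ t <= l i].
Proof.
move=> cT eD el t0; apply: contrapT => /infiniteP/pcard_leP[f].
pose x_ n := e (f n).
have fP n : D (f n) /\ t <= l (f n) by exact: (@funS _ _ _ _ f n).
have xx n : rin (x_ n) (x_ n) = 1.
  by rewrite /rin /x_ (eD _ _ (fP n).1 (fP n).1) eqxx -(of_real1 R cplx) re_of_real.
have hx n : hn (x_ n) = 1 by rewrite /hn xx sqrtr1.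
have [|y hy] := @compact_cluster _ _ _ T x_ cT.
  by move=> n; rewrite hx.
have t40 : 0 < t / 4 by rewrite divr_gt0.
have [n _ hn1] := hy (t / 4) 0 t40.
have [m nm hn2] := hy (t / 4) n.+1 t40.
have h : hn (T (x_ n) - T (x_ m)) < t / 2.
  rewrite (le_lt_trans (hn_tri y _ _))// (hnC y).
  by move: hn1 hn2; lra.
have := le_lt_trans (le_trans (ler_norm _) (rin_le (T (x_ n) - T (x_ m)) (x_ n))) _.
move=> /(_ (t / 2)); rewrite hx mulr1 => /(_ h).
have [[Dn tn] [Dm tm]] := (fP n, fP m).
have nm0 : rin (x_ m) (x_ n) = 0.
  rewrite /rin /x_ (eD _ _ Dm Dn); case: eqP => [fmn|_]; last by rewrite re0.
  have := @inj _ _ _ f m n; rewrite !inE => /(_ Logic.I Logic.I fmn) mn.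
  by rewrite mn ltnn in nm.
rewrite rinBl /x_ (el _ Dn) (el _ Dm) -/(x_ n) -/(x_ m) !rinZl xx nm0 mulr0 subr0 mulr1.
by move: tn t0; lra.
Qed.

Lemma csubspace_sum (J : Type) (s : seq J) (P : pred J) (F : J -> H) N :
  csubspace N -> (forall j, P j -> N (F j)) -> N (\sum_(j <- s | P j) F j).
Proof. by case=> N0 ND _ _ h; elim/big_ind: _. Qed.

Lemma diagonalization : compact_nonneg_sa T ->
  exists (D : set H) (l : H -> R), diagonalizes D id l.
Proof.
move=> [cT saT T0].
(* The family is a set of vectors indexed by itself, so that Zorn's lemma applies to plain
   inclusion. *)
pose P (E : set H) := (forall x, E x -> inner H x x = 1 /\
    exists2 a, 0 < a & T x = ofR a *: x) /\
  (forall x y, E x -> E y -> x <> y -> inner H x y = 0).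
have [F FP Ftot|E [[E1 E2] Emax]] := @Zorn_bigcup _ P.
  split=> [x [X FX Xx]|x y [X FX Xx] [Y FY Yy] xy].
    exact: (FP _ FX).1.
  have [XY|YX] := Ftot _ _ FX FY; first by apply: (FP _ FY).2 => //; exact: XY.
  by apply: (FP _ FX).2 => //; exact: YX.
have {}Emax a y : 0 < a -> y != 0 -> T y = ofR a *: y ->
    (forall x, E x -> inner H y x = 0) -> False.
  move=> a0 y0 Ty yE; pose z := ofR (hn y)^-1 *: y.
  have hy : 0 < hn y.
    by rewrite lt0r hn_ge0 andbT; apply/negP => /eqP/hn_eq0/eqP; exact/negP.
  have zz : inner H z z = 1.
    rewrite inner_xx /z rinZl rinZr -sqr_hn -(of_real1 R cplx); congr ofR.
    by field; rewrite gt_eqF.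
  have zE x : E x -> inner H z x = 0 by move=> Ex; rewrite innerZl yE// mulr0.
  have nEz : ~ E z.
    by move=> /zE; rewrite zz => /eqP; rewrite oner_eq0.
  apply: (Emax (E `|` [set z])).
    split; first by exact: subsetUl.
    by move=> /(_ z) h; apply/nEz/h; right.
  split=> [x [/E1//|->]|x x' [Ex|->] [Ex'|->]//].
  - by split=> //; exists a => //; rewrite opZ Ty !scalerA mulrC.
  - exact: E2.
  - by move=> _; apply: inner_eq0C; exact: zE.
  - by move=> _; exact: zE.
pose l x := rin (T x) x.
have El x : E x -> 0 < l x /\ T x = ofR (l x) *: x.
  move=> /E1[xx [a a0 Tx]].
  suff -> : l x = a by [].
  by rewrite /l Tx rinZl /rin xx -(of_real1 R cplx) re_of_real mulr1.
have eE : ortho_family E id.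
  move=> x y Ex Ey; case: eqP => [<-|xy]; first by have [-> _] := E1 _ Ex.
  exact: E2.
have Efin t : 0 < t -> finite_set [set i | E i /\ t <= l i].
  by apply: (eigenvalues_finite cT eE) => i /El[].
exists E, l; split=> // x N Nsub EN.
have [N0 ND NZ Ncl] := Nsub.
apply: Ncl => d d0.
have hx : 0 < hn x + 1 by rewrite ltr_wpDl// hn_ge0.
pose eps := d / (hn x + 1); have eps0 : 0 < eps by rewrite divr_gt0.
pose A := fset_set [set i | E i /\ eps <= l i].
have AP v : (v \in A) = (v \in [set i | E i /\ eps <= l i]).
  by rewrite in_fset_set//; exact: Efin.
have AE : [set` A] `<=` E by move=> v /=; rewrite AP inE => -[].
(* The approximant lies in the span of the finitely many eigenvectors with eigenvalue at least
   [eps]. The error is [T] applied to the residual, of norm at most [eps * hn x <= d]. *)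
exists (T (proj id A x)).
  rewrite /proj raddf_sum big_seq; apply: csubspace_sum => // v vA.
  rewrite /= opZ; apply: (NZ); rewrite (El v (AE _ vA)).2; apply: (NZ).
  by apply: EN; exists v => //; exact: AE.
rewrite -opB -/(perp id A x).
pose M := [set z : H | forall v, [set` A] v -> inner H z v = 0].
have Msub : csubspace M by exact: csubspace_orth.
have MT z : M z -> M (T z).
  move=> Mz v vA; apply: (@invariant_orth _ _ _ T saT _ l z _ Mz v vA) => w wA.
  by have [] := El w (AE _ wA).
have Mbound z : M z -> rin (T z) z <= eps * rin z z.
  move=> Mz; rewrite leNgt; apply/negP => hz.
  have [lam [y [elam My y0 Ty]]] :=
    exists_eigenvector saT T0 cT Msub MT eps0 Mz hz.
  apply: (Emax lam y) => // [|v Ev]; first exact: lt_trans elam.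
  (* [y] is orthogonal to the vectors of [A] because it lies in [M], and to the others because their
     eigenvalues are below [eps < lam]. *)
  have [evl|lve] := leP eps (l v).
    by apply: My; rewrite /= AP inE.
  apply: (orth_eigenvec saT Ty (El v Ev).2).
  by rewrite gt_eqF// (lt_trans lve).
have Mp : M (perp id A x).
  by move=> v vA; rewrite (inner_perp eE)// ?vA//; exact: AE.
rewrite (le_trans (op_form_bound saT T0 (ltW eps0) MT Mbound Mp))//.
rewrite (le_trans (ler_wpM2l (ltW eps0) (hn_perp eE x AE)))//.
by rewrite /eps mulrAC ler_pdivrMr// ler_pM2l// lerDl.
Qed.

End Diagonal.

(** * Sorting a family of positive numbers *)

Section Rearrangement.
Variables (R : realType) (I : choiceType) (D : set I) (l : I -> R).
Hypothesis lfin : forall t, 0 < t -> finite_set [set i | D i /\ t <= l i].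

(** [m] is the largest listed value below [mu], or [m0] if that is larger: values taken from a
    finite list leave a gap just under [mu]. *)
Lemma seq_gap_below (s : seq R) mu m0 : m0 < mu ->
  exists m, [/\ m0 <= m, m < mu & forall x, x \in s -> x < mu -> x <= m].
Proof.
move=> m0mu; elim: s => [|a s [m [m0m mmu IH]]]; first by exists m0.
have [amu|mua] := ltP a mu.
  exists (Num.max a m); split=> [||x]; rewrite ?le_max ?m0m ?orbT ?gt_max ?amu//.
  by rewrite inE => /orP[/eqP->|/IH h /h ->]; rewrite ?lexx ?orbT.
exists m; split=> // x; rewrite inE => /orP[/eqP->|]; last exact: IH.
by rewrite ltNge mua.
Qed.

Lemma seq_gap_above (s : seq R) mu m0 : mu < m0 ->
  exists m, [/\ m <= m0, mu < m & forall x, x \in s -> mu < x -> m <= x].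
Proof.
move=> m0mu; have [|m [m0m mmu h]] := @seq_gap_below (map -%R s) (- mu) (- m0).
  by rewrite ltrN2.
exists (- m); split=> [||x xs mux].
- by rewrite lerNl.
- by rewrite ltrNr.
- rewrite lerNl; apply: h; last by rewrite ltrN2.
  exact: map_f.
Qed.

Let Nge t := #|` fset_set [set i | D i /\ t <= l i]|.
Let Ngt t := #|` fset_set [set i | D i /\ t < l i]|.

Lemma lfin_gt t : 0 < t -> finite_set [set i | D i /\ t < l i].
Proof.
by move=> t0; apply: sub_finite_set (lfin t0) => i [? /ltW].
Qed.

(* The generalized inverse [lam n = sup {t | n < #{i | t <= l i}}]. *)
Lemma decreasing_rearrangement : exists lam : nat -> R,
  [/\ nonincreasing_seq lam, forall n, 0 <= lam n &
    forall mu, 0 < mu -> ([set n | lam n = mu] #= [set i | D i /\ l i = mu])%card].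
Proof.
have Nge_le a b : 0 < a -> 0 < b ->
    [set i | D i /\ a <= l i] `<=` [set i | D i /\ b <= l i] -> (Nge a <= Nge b)%N.
  by move=> a0 b0 ab; apply: fsubset_leq_card; rewrite -fset_set_sub//; exact: lfin.
(* The element 0 makes the set nonempty and produces the zero padding of the sequence. *)
pose S n := [set t | t = 0 \/ (0 < t /\ (n < Nge t)%N)].
pose lam n := sup (S n).
have S_sup n : has_sup (S n).
  split; first by exists 0; left.
  (* The threshold exceeds every listed value, so [m] bounds all [l i >= 1]; the 2 puts it above
     1. *)
  have [m [m0m _ h]] := @seq_gap_below
      [seq l i | i <- fset_set [set i | D i /\ 1 <= l i]]
      (\sum_(i <- fset_set [set i | D i /\ 1 <= l i]) `|l i| + 2) 1
      (ltr_wpDl (sumr_ge0 _ (fun _ _ => normr_ge0 _)) (ltr1n _ 2)).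
  exists m => t [->|[t0 nN]]; first exact: le_trans m0m.
  have [t1|t1] := leP t 1; first exact: le_trans m0m.
  have : fset_set [set i | D i /\ t <= l i] != fset0.
    by rewrite -cardfs_gt0; exact: leq_ltn_trans nN.
  move=> /fset0Pn[i ]; rewrite in_fset_set ?inE; last exact: lfin.
  move=> [Di tl]; rewrite (le_trans tl)// h//.
    apply: map_f; rewrite in_fset_set ?inE; last exact: lfin.
    by split=> //; rewrite (le_trans _ tl)// ltW.
  rewrite (le_lt_trans (ler_norm _))// (big_fsetD1 i)/=; last first.
    rewrite in_fset_set ?inE; last exact: lfin.
    by split=> //; rewrite (le_trans _ tl)// ltW.
  by rewrite -addrA ltrDl ltr_wpDl// sumr_ge0.
have lam0 n : 0 <= lam n by apply: (ub_le_sup (S_sup n).2); left.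
(* The supremum is in effect attained: no [l i] lies strictly between the gap point [m] and [mu], so
   [Nge] does not change when its argument moves down from [mu] within that gap. *)
have lam_ge n mu : 0 < mu -> (mu <= lam n) = (n < Nge mu)%N.
  move=> mu0; apply/idP/idP => [mul|nN]; last first.
    by apply: (ub_le_sup (S_sup n).2); right.
  rewrite ltnNge; apply/negP => Nn.
  have mu2 : mu / 2 < mu by rewrite ltr_pdivrMr// ltr_pMr// ltr1n.
  have [m [m0m mmu h]] := @seq_gap_below
      [seq l i | i <- fset_set [set i | D i /\ mu / 2 <= l i]] mu (mu / 2) mu2.
  have m0 : 0 < m by rewrite (lt_le_trans _ m0m)// divr_gt0.
  have d0 : 0 < mu - m by rewrite subr_gt0.
  have [t St tm] := sup_adherent d0 (S_sup n).
  have {tm} mt : m < t by rewrite -/(lam n) in tm; move: tm mul; lra.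
  case: St => [t0|[t0 nN]]; first by move: mt; rewrite t0 ltNge (ltW m0).
  have : (Nge t <= Nge mu)%N.
    apply: Nge_le => // i [Di tl]; split=> //; rewrite leNgt; apply/negP => lmu.
    have : l i <= m.
      apply: h => //; apply: map_f; rewrite in_fset_set ?inE; last first.
        by apply: lfin; rewrite divr_gt0.
      by split=> //; rewrite (le_trans m0m)// (le_trans (ltW mt)).
    by apply/negP; rewrite -ltNge (lt_le_trans mt).
  by apply/negP; rewrite -ltnNge (leq_ltn_trans Nn).
have lam_gt n mu : 0 < mu -> (mu < lam n) = (n < Ngt mu)%N.
  move=> mu0; apply/idP/idP => [mul|nN].
    have l0 := lt_trans mu0 mul.
    have := lexx (lam n); rewrite lam_ge// => /leq_trans; apply.
    apply: fsubset_leq_card; rewrite -fset_set_sub; [|exact: lfin|exact: lfin_gt].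
    by move=> i [Di /(lt_le_trans mul)].
  have mu1 : mu < mu + 1 by rewrite ltrDl.
  have [m [m0m mmu h]] := @seq_gap_above
      [seq l i | i <- fset_set [set i | D i /\ mu < l i]] mu (mu + 1) mu1.
  rewrite (lt_le_trans mmu)// lam_ge ?(lt_trans mu0)// (leq_trans nN)//.
  apply: fsubset_leq_card; rewrite -fset_set_sub; [|exact: lfin_gt|].
    move=> i [Di mul]; split=> //; apply: h => //; apply: map_f.
    by rewrite in_fset_set ?inE//; exact: lfin_gt.
  by apply: lfin; exact: lt_trans mmu.
exists lam; split=> // [m n mn|mu mu0].
  have [l0|] := ltP 0 (lam n); last by move=> /le_trans; apply.
  by rewrite lam_ge// (leq_ltn_trans mn)// -lam_ge.
(* Both level sets are differences of nested finite sets with cardinals [Nge mu] and [Ngt mu]. *)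
have lamE : [set n | lam n = mu] = `I_(Nge mu) `\` `I_(Ngt mu).
  apply/seteqP; split=> n /=.
    by move=> lE; rewrite -lam_ge// -lam_gt// lE lexx ltxx.
  by rewrite -lam_ge// -lam_gt// => -[mul /negP]; rewrite -leNgt => lmu; apply/eqP; rewrite eq_le lmu.
have lE : [set i | D i /\ l i = mu] =
    [set i | D i /\ mu <= l i] `\` [set i | D i /\ mu < l i].
  apply/seteqP; split=> i /=.
    by move=> [Di ->]; rewrite lexx ltxx; split=> // -[].
  move=> [[Di mul] h]; split=> //; apply/eqP; rewrite eq_le mul andbT leNgt.
  by apply/negP => mul'; apply: h.
rewrite lamE lE; apply/fcard_eq.
- exact/finite_setD/finite_II.
- exact/finite_setD/lfin.
rewrite !fset_setD ?finite_II//; [|exact: lfin|exact: lfin_gt].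
have Igt_ge : (Ngt mu <= Nge mu)%N.
  apply: fsubset_leq_card; rewrite -fset_set_sub; [|exact: lfin_gt|exact: lfin].
  by move=> i [Di /ltW].
rewrite !cardfsD.
have -> : (fset_set `I_(Nge mu) `&` fset_set `I_(Ngt mu) = fset_set `I_(Ngt mu))%fset.
  apply/fsetIidPr; rewrite -fset_set_sub ?finite_II// => n /= h.
  exact: leq_trans Igt_ge.
have -> : (fset_set [set i | D i /\ (mu <= l i)%R] `&`
    fset_set [set i | D i /\ (mu < l i)%R] = fset_set [set i | D i /\ (mu < l i)%R])%fset.
  apply/fsetIidPr; rewrite -fset_set_sub; [|exact: lfin_gt|exact: lfin].
  by move=> i [Di /ltW].
by rewrite !(card_fset_set (card_eqxx _)).
Qed.

End Rearrangement.

(** * Multiplicities and the eigenvalue sequence *)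

Section Eigenvalues.
Variables (R : realType) (cplx : bool) (H : hilbert R cplx).
Variable T : {linear H -> H}.
Local Notation K := (base_field R cplx).
Local Notation ofR := (@of_real R cplx).

Lemma of_real_eq0 (a : R) : (ofR a == 0) = (a == 0).
Proof. by rewrite -(of_real0 R cplx) eq_le !le_of_real -eq_le. Qed.

(** Expand each basis in the other. By uniqueness of coordinates the two coefficient matrices
    multiply to the identity of size [d], which forces the rank bound. *)
Lemma has_dim_le (V : set H) d d' : has_dim V d -> has_dim V d' -> (d <= d')%N.
Proof.
move=> [e [Ve e_basis]] [e' [Ve' e'_basis]].
have ea i : exists c : {ffun 'I_d' -> K}, e i = \sum_j c j *: e' j.
  by have [c [h _]] := e'_basis _ (Ve i); exists c.
have eb i : exists c : {ffun 'I_d -> K}, e' i = \sum_j c j *: e j.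
  by have [c [h _]] := e_basis _ (Ve' i); exists c.
have [[a aP] [b bP]] := (choice ea, choice eb).
apply: (@mulmx1_min K d d' (\matrix_(i, j) a i j) (\matrix_(i, j) b i j)).
apply/matrixP => i k; rewrite !mxE.
have [c [_ c_unique]] := e_basis _ (Ve i).
have h1 := c_unique [ffun k => (i == k)%:R].
have h2 := c_unique [ffun k => \sum_j a i j * b j k].
have {}h1 : c = [ffun k => (i == k)%:R].
  apply: h1; rewrite (bigD1 i)//= ffunE eqxx scale1r big1 ?addr0// => j ji.
  by rewrite ffunE eq_sym (negPf ji) scale0r.
have {}h2 : c = [ffun k => \sum_j a i j * b j k].
  apply: h2; rewrite {1}(aP i).
  under eq_bigr => j _ do rewrite (bP j) scaler_sumr.
  rewrite exchange_big; apply: eq_bigr => /= m _.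
  by rewrite ffunE scaler_suml; apply: eq_bigr => j _; rewrite scalerA.
have := congr1 (fun f : {ffun _} => f k) (esym h2).
rewrite h1 !ffunE => <-.
by apply: eq_bigr => j _; rewrite !mxE.
Qed.

Lemma has_dim_unique (V : set H) d d' : has_dim V d -> has_dim V d' -> d = d'.
Proof. by move=> Vd Vd'; apply/eqP; rewrite eqn_leq !(@has_dim_le V). Qed.

Section Diag.
Variables (I : choiceType) (D : set I) (e : I -> H) (l : I -> R).
Hypothesis saT : self_adjoint T.
Hypothesis diagT : diagonalizes T D e l.

Lemma level_finite mu : 0 < mu -> finite_set [set i | D i /\ l i = mu].
Proof.
case: diagT => _ _ lfin _ mu0; apply: sub_finite_set (lfin _ mu0).
by move=> i /= [Di ->].
Qed.

Lemma eigenspace_has_dim mu : 0 < mu ->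
  has_dim (eigenspace_of T mu) #|` fset_set [set i | D i /\ l i = mu]|.
Proof.
move=> mu0; have [eD el _ Tspan] := diagT.
set A := fset_set _.
have AP i : (i \in A) = (i \in [set i | D i /\ l i = mu]).
  by rewrite in_fset_set//; exact: level_finite.
have AD : [set` A] `<=` D by move=> i /=; rewrite AP inE => -[].
have Al i : i \in A -> l i = mu by rewrite AP inE => -[].
pose f (i : 'I_#|` A|) := tnth (in_tuple A) i.
have fA i : f i \in A by exact: mem_tnth.
have f_inj : injective f by apply/tuple_uniqP; exact: fset_uniq.
have f_sum (c : I -> K) : \sum_(i <- A) c i *: e i = \sum_i c (f i) *: e (f i).
  by rewrite big_tnth.
have eigE i : i \in A -> eigenspace_of T mu (e i).
  by move=> iA; rewrite /eigenspace_of /= (el i (AD _ iA)).2 Al.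
exists (e \o f); split=> [i|v Tv]; first exact: eigE.
exists [ffun i => inner H v (e (f i))]; split.
  (* The residual [w] is again an eigenvector for [mu], hence a multiple of [T w] and in the closed
     span of the family; yet it is orthogonal to all [e i], by projection if [l i = mu] and by
     distinct eigenvalues otherwise. *)
  have : perp e A v = 0.
    set w := perp e A v.
    have Tw : T w = ofR mu *: w.
      rewrite /w /perp opB Tv scalerBr; congr (_ - _).
      rewrite /proj raddf_sum scaler_sumr big_seq [RHS]big_seq.
      apply: eq_bigr => i iA /=.
      by rewrite opZ (eigE _ iA) !scalerA mulrC.
    have wE : w = (ofR mu)^-1 *: T w.
      by rewrite Tw scalerA mulVf ?scale1r// of_real_eq0 gt_eqF.
    apply: rin_eq0; rewrite /rin {1}wE innerZl.
    rewrite (cspan_orth _ (Tspan w)) ?mulr0 ?re0// => _ [i Di <-].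
    apply: inner_eq0C; have [iA|iA] := boolP (i \in A).
      by rewrite (inner_perp eD)// iA.
    apply: (orth_eigenvec saT Tw (el i Di).2); apply: contra iA => /eqP muE.
    by rewrite AP inE.
  move=> /eqP; rewrite subr_eq0 => /eqP {1}->; rewrite /proj f_sum.
  by apply: eq_bigr => i _; rewrite ffunE.
move=> c vE; apply/ffunP => i; rewrite ffunE vE inner_suml (bigD1 i)//=.
rewrite innerZl (eD _ _ (AD _ (fA i)) (AD _ (fA i))) eqxx mulr1.
rewrite big1 ?addr0// => j ji.
rewrite innerZl (eD _ _ (AD _ (fA j)) (AD _ (fA i))).
by rewrite (inj_eq f_inj) (negPf ji) mulr0.
Qed.

Lemma eigenvalue_seq_exists : exists lam, is_eigenvalue_seq T lam.
Proof.
have [_ _ lfin _] := diagT.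
have [lam [lam_dec lam0 lamP]] := decreasing_rearrangement lfin.
exists lam; split=> // mu mu0.
exists #|` fset_set [set i | D i /\ l i = mu]|.
split; first exact: eigenspace_has_dim.
rewrite (card_eql (lamP _ mu0)); apply/fcard_eq; [exact: level_finite|exact: finite_II|].
by rewrite [RHS](card_fset_set (card_eqxx _)).
Qed.

End Diag.

(** For each [mu] the indices with value [mu] have on both sides as many elements as the eigenspace
    has dimensions. A bijection is chosen on every level, and the levels are glued. *)
Lemma eigenvalue_seq_reindex (I : pointedType) (D : set I) (e : I -> H)
    (l : I -> R) lam :
  self_adjoint T -> diagonalizes T D e l -> is_eigenvalue_seq T lam ->
  exists2 sigma : nat -> I, set_bij [set n | 0 < lam n] D sigma &
    forall n, 0 < lam n -> l (sigma n) = lam n.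
Proof.
move=> saT diagT [lam_dec lam0 lamP].
have [eD el lfin _] := diagT.
have level mu : exists f : nat -> I, 0 < mu ->
    set_bij [set n | lam n = mu] [set i | D i /\ l i = mu] f.
  have [mu0|mu0] := ltP 0 mu; last by exists (fun=> point).
  have [d [Vd lamd]] := lamP _ mu0.
  have dE := has_dim_unique Vd (eigenspace_has_dim saT diagT mu0).
  suff /card_set_bijP[f fP] : ([set n | lam n = mu] #= [set i | D i /\ l i = mu])%card.
    by exists f.
  rewrite (card_eql lamd); apply/fcard_eq; [exact: finite_II|exact: level_finite diagT _ mu0|].
  by rewrite (card_fset_set (card_eqxx _)).
have [f fP] := choice level.
exists (fun n => f (lam n) n) => [|n n0]; last first.
  by have [h _ _] := fP _ n0; have [] := h n erefl.
split=> [n /= n0|m n|i Di].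
- by have [h _ _] := fP _ n0; have [] := h n erefl.
- rewrite !inE /= => m0 n0 fmn.
  have [hm _ _] := fP _ m0; have [_ lm] := hm m erefl.
  have [hn hinj _] := fP _ n0; have [_ ln] := hn n erefl.
  have lmn : lam m = lam n by rewrite -lm -ln fmn.
  by apply: hinj; rewrite ?inE//= -lmn fmn lmn.
- have [l0 _] := el _ Di; have [_ _ hs] := fP _ l0.
  by have [n /= ln fn] := hs i (conj Di erefl); exists n; rewrite /= ?ln.
Qed.

Lemma diagonalizes_reindex (I : choiceType) (D : set I) (e : I -> H)
    (l : I -> R) (lam : nat -> R) (sigma : nat -> I) :
  diagonalizes T D e l -> set_bij [set n | 0 < lam n] D sigma ->
  (forall n, 0 < lam n -> l (sigma n) = lam n) ->
  diagonalizes T [set n | 0 < lam n] (e \o sigma) lam.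
Proof.
move=> [eD el lfin Tspan] [sD sinj ssurj] sl; split=> [m n m0 n0|n n0|t t0|x] /=.
- rewrite (eD _ _ (sD _ m0) (sD _ n0)); congr (_%:R); congr nat_of_bool.
  apply/eqP/eqP => [|->//]; apply: sinj; rewrite inE//.
- by have [_ ->] := el _ (sD _ n0); rewrite sl.
- have ex i : exists n, D i -> 0 < lam n /\ sigma n = i.
    have [Di|nDi] := pselect (D i); last by exists 0%N.
    by have [n n0 <-] := ssurj i Di; exists n.
  have [tau tauP] := choice ex.
  apply: sub_finite_set (finite_image tau (lfin _ t0)) => n /= [n0 tn].
  exists (sigma n); first by rewrite sl//; split=> //; exact: sD.
  have [tn0 stn] := tauP _ (sD _ n0).
  by apply: sinj; rewrite ?inE.
- suff -> : (e \o sigma) @` [set n | 0 < lam n] = e @` D by exact: Tspan.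
  apply/seteqP; split=> [_ [n n0 <-]|_ [i Di <-]].
    by exists (sigma n) => //; exact: sD.
  by have [n n0 <-] := ssurj i Di; exists n.
Qed.

Lemma eigval_seqP : compact_nonneg_sa T -> is_eigenvalue_seq T (eigval_seq T).
Proof.
move=> cnT; have [D [l diagT]] := diagonalization cnT.
have [_ saT _] := cnT.
have [lam lamP] := eigenvalue_seq_exists saT diagT.
by apply: xgetPex; exists lam.
Qed.

Lemma eigval_seq_diagonalizes : compact_nonneg_sa T ->
  exists e : nat -> H,
    diagonalizes T [set n | 0 < eigval_seq T n] e (eigval_seq T).
Proof.
move=> cnT; have [D [l diagT]] := diagonalization cnT.
have [_ saT _] := cnT.
have [sigma sD sl] := eigenvalue_seq_reindex saT diagT (eigval_seqP cnT).
exists (id \o sigma); exact: (diagonalizes_reindex diagT sD sl).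
Qed.

(** Frees the count from the chosen sequence; for the tensor product it is used with pairs of
    indices. *)
Lemma counting_functionE (I : pointedType) (D : set I) (e : I -> H)
    (l : I -> R) t :
  compact_nonneg_sa T -> diagonalizes T D e l -> 0 < t ->
  counting_function T t = (#|` fset_set [set i | D i /\ t < l i]|)%:R.
Proof.
move=> cnT diagT t0; have [_ saT _] := cnT.
have [sigma [sD sinj ssurj] sl] := eigenvalue_seq_reindex saT diagT (eigval_seqP cnT).
have [e' [_ _ lamfin _]] := eigval_seq_diagonalizes cnT.
have [_ _ lfin _] := diagT.
rewrite /counting_function; congr (_%:R); apply/fcard_eq.
- by apply: sub_finite_set (lamfin _ t0) => n /= tn; split; [exact: lt_trans tn|exact: ltW].
- by apply: sub_finite_set (lfin _ t0) => i /= [Di /ltW].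
apply/card_set_bijP; exists sigma; split=> [n /= tn|m n|i /= [Di tl]].
- have n0 := lt_trans t0 tn.
  by rewrite sl//; split=> //; exact: sD.
- rewrite !inE /= => tm tn; apply: sinj; rewrite inE /=; exact: lt_trans t0 _.
- have [n n0 ni] := ssurj i Di; exists n => //=.
  by rewrite -sl// ni.
Qed.

End Eigenvalues.

(** Along an ultrafilter a bounded real function has a cluster point in a compact segment, and some
    member is mapped into a small ball around it. This replaces a diagonal extraction over the
    coordinates. *)
Lemma ultra_oscillation (R : realType) (X : Type) (U : set_system X)
    (f : X -> R) B d : UltraFilter U -> U [set u | `|f u| <= B] -> 0 < d ->
  exists2 V, U V & forall u u', V u -> V u' -> `|f u - f u'| <= d.
Proof.
move=> UU UB d0.
have [|p [_ pc]] := @segment_compact R (- B) B (f @ U) _.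
  suff : U (f @^-1` `[- B, B]) by [].
  by apply: filterS UB => u /=; rewrite in_itv /= ler_norml.
pose V := f @^-1` ball p (d / 2).
have d20 : 0 < d / 2 by rewrite divr_gt0.
exists V => [|u u'].
  have [//|UV] := in_ultra_setVsetC V UU.
  have [z [/= nz bz]] := pc (~` ball p (d / 2)) _ UV (nbhsx_ballx p _ d20).
  by [].
rewrite /V /= -ball_normE /= => pu pu'.
rewrite -(subrKA p) (le_trans (ler_normD _ _))// (splitr d).
by rewrite lerD// ltW// distrC.
Qed.

Lemma ultra_oscillation_seq (R : realType) (X : Type) (J : eqType) (U : set_system X)
    (s : seq J) (f : J -> X -> R) B d : UltraFilter U ->
  (forall j, j \in s -> U [set u | `|f j u| <= B]) -> 0 < d ->
  exists2 V, U V & forall u u' j, V u -> V u' -> j \in s -> `|f j u - f j u'| <= d.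
Proof.
move=> UU UB d0; elim: s UB => [|j s IH] UB.
  by exists setT; [exact: filterT|].
have [|V UV VP] := IH; first by move=> i si; apply: UB; rewrite inE si orbT.
have [W UW WP] := ultra_oscillation UU (UB j (mem_head _ _)) d0.
exists (V `&` W); first exact: filterI.
move=> u u' i [Vu Wu] [Vu' Wu']; rewrite inE => /orP[/eqP->|]; first exact: WP.
exact: VP.
Qed.

(** * Compactness and positivity of a diagonalized operator *)

Section DiagonalOperator.
Variables (R : realType) (cplx : bool) (H : hilbert R cplx).
Variable T : {linear H -> H}.
Local Notation K := (base_field R cplx).
Local Notation ofR := (@of_real R cplx).
Variables (I : choiceType) (D : set I) (e : I -> H) (l : I -> R).
Hypothesis saT : self_adjoint T.
Hypothesis diagT : diagonalizes T D e l.

(** The coordinates of [T x] are those of [x] times [l i], so Bessel's inequality bounds every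
    finite projection of [T x]. As [T x] lies in the closed span, the residual is arbitrarily
    small. *)
Lemma diagonal_op_le (F : {fset I}) eps x : 0 <= eps ->
  (forall i, D i -> i \notin F -> l i <= eps) ->
  (forall i, D i -> i \in F -> inner H x (e i) = 0) ->
  hn (T x) <= eps * hn x.
Proof.
have [eD el _ Tspan] := diagT.
move=> eps0 lF xF; rewrite hn_le ?mulr_ge0 ?hn_ge0//.
apply/ler_addgt0Pl => d d0; rewrite addrC.
have sd0 : 0 < Num.sqrt d by rewrite sqrtr_gt0.
have [G GD hG] := cspan_approx eD (Tspan x) sd0.
rewrite (pythagoras eD (T x) GD); apply: lerD; last first.
  by rewrite -sqr_hn -[leRHS](sqr_sqrtr (ltW d0)) ler_pXn2r ?nnegrE ?hn_ge0// ltW.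
rewrite (rin_sume eD _ GD) exprMn sqr_hn.
rewrite (le_trans _ (ler_wpM2l (sqr_ge0 eps) (bessel eD x GD)))//.
rewrite mulr_sumr big_seq [leRHS]big_seq; apply: ler_sum => i iG.
have Di : D i by exact: GD.
have [li Ti] := el i Di.
rewrite saT Ti innerZr sconj_of_real.
have [iF|iF] := boolP (i \in F); first by rewrite xF// mulr0 !mul0r re0 mulr0.
rewrite sconjM sconj_of_real mulrACA -of_realM reZ -expr2.
rewrite ler_wpM2r ?re_ge0 ?mul_sconj_ge0// ler_pXn2r ?nnegrE ?(ltW li)//.
exact: lF.
Qed.

Lemma diagonal_op_nonneg : nonnegative T.
Proof.
have [eD el _ Tspan] := diagT => x.
have -> : inner H (T x) x = ofR (rin (T x) x).
  by apply: sconj_id; rewrite -innerC saT.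
rewrite -(of_real0 R cplx) le_of_real.
apply/ler_addgt0Pl => d d0.
have hx : 0 < hn x + 1 by rewrite ltr_wpDl// hn_ge0.
have [G GD hG] := cspan_approx eD (Tspan x) (divr_gt0 d0 hx).
have h1 : 0 <= rin (proj e G (T x)) x.
  apply: re_ge0; rewrite inner_suml big_seq; apply: sumr_ge0 => i iG.
  have [li Ti] := el i (GD _ iG).
  rewrite innerZl saT Ti innerZr sconj_of_real (innerC (e i)) -mulrA mulr_ge0 ?mul_sconj_ge0//.
  by rewrite -(of_real0 R cplx) le_of_real ltW.
have h2 : `|rin (perp e G (T x)) x| <= d.
  rewrite (le_trans (rin_le _ _))//.
  rewrite (le_trans (ler_wpM2r (hn_ge0 x) hG))// mulrAC ler_pdivrMr//.
  by rewrite ler_pM2l// lerDl.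
have -> : rin (T x) x = rin (proj e G (T x)) x + rin (perp e G (T x)) x.
  by rewrite -rinDl /perp subrKC.
by move: h1 h2; rewrite ler_norml => h1 /andP[h2 _]; lra.
Qed.

Lemma perp_op (F : {fset I}) x : [set` F] `<=` D -> perp e F (T x) = T (perp e F x).
Proof.
move=> FD; have [eD el _ _] := diagT.
rewrite /perp opB; congr (_ - _); rewrite /proj raddf_sum big_seq [RHS]big_seq.
apply: eq_bigr => i iF /=; have [_ Ti] := el i (FD _ iF).
by rewrite opZ Ti saT Ti innerZr sconj_of_real scalerA mulrC.
Qed.

(** An ultrafilter on the closed image of the unit ball is shown to be Cauchy: its finitely many
    coordinates with [l i >= eps] are nearly constant on a member, and the remainder is uniformly
    small. Completeness supplies the limit. *)
Lemma diagonal_op_compact : bounded_op T -> compact_operator T.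
Proof.
move=> [C C0 TC]; have [eD el lfin Tspan] := diagT.
rewrite /compact_operator precompactE compact_ultra => U UU US.
set S := T @` _ in US.
suff cU : cvg U.
  exists (lim U); split=> //.
  apply: (@closed_cvg _ _ U _ id _ (@closed_closure _ S)) => //.
apply: cauchy_cvg; apply/cauchy_ballP => e' e'0.
have [ep epE] : exists ep : R, e' = ofR ep by exists (re e'); apply: ge0_of_real; exact: ltW.
have ep0 : 0 < ep by rewrite -(lt_of_real cplx) of_real0 -epE.
(* The coordinates in [F] will contribute at most [eps ^+ 2] and the residual at most
   [(4 * eps) ^+ 2]; the sum is below [(5 * eps) ^+ 2], and [5 * eps < ep]. *)
pose eps := ep / 6.
have eps0 : 0 < eps by rewrite divr_gt0.
pose F := fset_set [set i | D i /\ eps <= l i].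
have FP i : (i \in F) = (i \in [set i | D i /\ eps <= l i]).
  by rewrite in_fset_set//; exact: lfin.
have FD : [set` F] `<=` D by move=> i /=; rewrite FP inE => -[].
have Sapprox u : closure S u -> hn (perp e F u) <= eps + eps /\ hn u <= C + eps.
  move=> clu.
  have [s [[x /= x1 <-]]] : S `&` ball u (ofR eps) !=set0.
    by apply: clu; apply: nbhsx_ballx; rewrite -(of_real0 R cplx) lt_of_real.
  rewrite -ball_normE /= normE lt_of_real => ux.
  have {}x1 : hn x <= 1 by rewrite -(le_of_real cplx) -normE of_real1.
  rewrite -{1 2}(subrK (T x) u); split.
    rewrite perpD (le_trans (hnD _ _))// lerD//.
      by rewrite (le_trans (hn_perp eD _ FD))// ltW.
    rewrite perp_op// (le_trans (@diagonal_op_le F eps _ (ltW eps0) _ _))//.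
    - move=> i Di iF; rewrite leNgt; apply: contra iF => li.
      by rewrite FP inE; split=> //; exact: ltW.
    - by move=> i Di iF; rewrite (inner_perp eD)// iF.
    - by rewrite ger_pMr// (le_trans (hn_perp eD _ FD)).
  rewrite (le_trans (hnD _ _))// addrC lerD//; last exact: ltW.
  by rewrite (le_trans (TC x))// ger_pMr.
have coord i u : D i -> re (inner H u (e i)) ^+ 2 + im (inner H u (e i)) ^+ 2 <= rin u u.
  move=> Di; rewrite -re_mul_sconj.
  have iD : [set` [fset i]%fset] `<=` D by move=> j /=; rewrite inE => /eqP->.
  by have := bessel eD u iD; rewrite big_seq_fset1.
have CE0 : 0 <= C + eps by rewrite addr_ge0// ltW.
(* Real and imaginary parts of all coordinates in [F] then add up to at most [eps ^+ 2]; the 1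
   covers an empty [F]. *)
pose dl := eps / (2 * (#|` F|%:R + 1)).
have F1 : 0 < #|` F|%:R + 1 :> R by rewrite ltr_wpDl.
have dl0 : 0 < dl by rewrite divr_gt0// mulr_gt0.
have [|V UV VP] := @ultra_oscillation_seq R _ _ U F (fun i u => re (inner H u (e i))) (C + eps) dl UU _ dl0.
  move=> i iF; apply: filterS US => u /Sapprox[_ hu] /=.
  have Di := FD _ iF.
  rewrite -(@ler_pXn2r _ 2) ?nnegrE// real_normK ?num_real//.
  rewrite (le_trans _ (y := rin u u))//; last by rewrite -hn_le.
  by rewrite (le_trans _ (coord i u Di))// lerDl sqr_ge0.
have [|W UW WP] := @ultra_oscillation_seq R _ _ U F (fun i u => im (inner H u (e i))) (C + eps) dl UU _ dl0.
  move=> i iF; apply: filterS US => u /Sapprox[_ hu] /=.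
  have Di := FD _ iF.
  rewrite -(@ler_pXn2r _ 2) ?nnegrE// real_normK ?num_real//.
  rewrite (le_trans _ (y := rin u u))//; last by rewrite -hn_le.
  by rewrite (le_trans _ (coord i u Di))// lerDr sqr_ge0.
have : U (closure S `&` (V `&` W)) by do 2?apply: filterI.
move=> UX.
exists (closure S `&` (V `&` W), closure S `&` (V `&` W)); first by split.
move=> -[u u'] /= [[clu [Vu Wu]] [clu' [Vu' Wu']]].
rewrite -ball_normE /= normE epE lt_of_real.
suff : hn (u - u') <= 5 * eps.
  by move=> /le_lt_trans; apply; rewrite /eps; move: ep0; lra.
have eps50 : 0 <= 5 * eps by rewrite mulr_ge0// ltW.
rewrite (hn_le _ eps50) (pythagoras eD (u - u') FD).
have h1 : hn (perp e F (u - u')) <= 4 * eps.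
  rewrite perpB (le_trans (hnB _ _))//.
  have [[h _] [h' _]] := (Sapprox _ clu, Sapprox _ clu').
  by rewrite (le_trans (lerD h h'))//; lra.
have {}h1 : rin (perp e F (u - u')) (perp e F (u - u')) <= (4 * eps) ^+ 2.
  by rewrite -hn_le// mulr_ge0// ltW.
rewrite (rin_sume eD _ FD).
have h2 : \sum_(i <- F) re (inner H (u - u') (e i) * sconj (inner H (u - u') (e i))) <= eps ^+ 2.
  apply: (@le_trans _ _ (\sum_(i <- F) (dl ^+ 2 + dl ^+ 2))).
    rewrite big_seq [leRHS]big_seq; apply: ler_sum => i iF.
    rewrite re_mul_sconj innerDl innerNl reD imD reN imN.
    have := VP u u' i Vu Vu' iF; have := WP u u' i Wu Wu' iF.
    move=> /= w v.
    by apply: lerD; rewrite -real_normK ?num_real// ler_pXn2r ?nnegrE ?(ltW dl0).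
  rewrite big_const_seq count_predT iter_addr_0 -mulr_natl.
  have -> : (size F)%:R * (dl ^+ 2 + dl ^+ 2) = eps ^+ 2 * ((size F)%:R / (2 * ((size F)%:R + 1) ^+ 2)).
    by rewrite /dl; field; rewrite gt_eqF.
  rewrite ger_pMr ?exprn_gt0// ler_pdivrMr ?mulr_gt0 ?exprn_gt0// mul1r.
  move: F1 (ler0n R (size F)); rewrite -/(size F); set N := (size F)%:R => F1 N0.
  by nra.
apply: (le_trans (lerD h2 h1)).
by rewrite !exprMn; nra.
Qed.

Lemma diagonal_op_compact_nonneg : bounded_op T -> compact_nonneg_sa T.
Proof.
by move=> bT; split=> //; [exact: diagonal_op_compact|exact: diagonal_op_nonneg].
Qed.

End DiagonalOperator.

(** * Tensor products of operators *)

Section Tensor.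
Variables (R : realType) (cplx : bool) (H H' : hilbert R cplx).
Variable L : hilbert_tensor H H'.
Local Notation K := (base_field R cplx).
Local Notation ofR := (@of_real R cplx).
Implicit Types (x : H) (y : H') (z w : L) (c : K).

Lemma tensDl x x' y : tens L (x + x') y = tens L x y + tens L x' y.
Proof. exact: linearDl. Qed.

Lemma tensDr x y y' : tens L x (y + y') = tens L x y + tens L x y'.
Proof. exact: linearDr. Qed.

Lemma tensZl c x y : tens L (c *: x) y = c *: tens L x y.
Proof. exact: linearZl_LR. Qed.

Lemma tensZr c x y : tens L x (c *: y) = c *: tens L x y.
Proof. exact: linearZr. Qed.

Lemma hn_tens x y : hn (tens L x y) = hn x * hn y.
Proof.
rewrite /hn -sqrtrM ?rin_ge0// /rin inner_tens !inner_xx -of_realM.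
by rewrite !re_of_real.
Qed.

Lemma csubspace_tensl (N : set L) y :
  csubspace N -> csubspace [set x | N (tens L x y)].
Proof.
move=> [N0 ND NZ Ncl]; split=> [|x x' hx hx'|c x hx|x hx] /=.
- by rewrite -(scale0r 0) tensZl scale0r.
- by rewrite tensDl; exact: ND.
- by rewrite tensZl; exact: NZ.
apply: Ncl => d d0; have hy : 0 < hn y + 1 by rewrite ltr_wpDl// hn_ge0.
have [v Nv xv] := hx _ (divr_gt0 d0 hy); exists (tens L v y) => //.
rewrite -scaleN1r -tensZl -tensDl scaleN1r hn_tens.
rewrite (le_trans (ler_wpM2r (hn_ge0 _) xv))// mulrAC ler_pdivrMr//.
by rewrite ler_pM2l// lerDl.
Qed.

Lemma csubspace_tensr (N : set L) x :
  csubspace N -> csubspace [set y | N (tens L x y)].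
Proof.
move=> [N0 ND NZ Ncl]; split=> [|y y' hy hy'|c y hy|y hy] /=.
- by rewrite -(scale0r 0) tensZr scale0r.
- by rewrite tensDr; exact: ND.
- by rewrite tensZr; exact: NZ.
apply: Ncl => d d0; have hx : 0 < hn x + 1 by rewrite ltr_wpDl// hn_ge0.
have [v Nv yv] := hy _ (divr_gt0 d0 hx); exists (tens L x v) => //.
rewrite -scaleN1r -tensZr -tensDr scaleN1r hn_tens mulrC.
rewrite (le_trans (ler_wpM2r (hn_ge0 _) yv))// mulrAC ler_pdivrMr//.
by rewrite ler_pM2l// lerDl.
Qed.

(** Density of the algebraic tensor product as an induction principle for closed linear
    properties. *)
Lemma cspan_tens z (N : set L) :
  csubspace N -> (forall x y, N (tens L x y)) -> N z.
Proof.
move=> Nsub Nt; apply: (dense_cspan (@dense_tens _ _ _ _ L)) => // _ [n [x [y ->]]].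
exact: csubspace_sum.
Qed.

Lemma csubspace_preimage (A : {linear L -> L}) (N : set L) :
  bounded_op A -> csubspace N -> csubspace [set z | N (A z)].
Proof.
move=> [C C0 AC] [N0 ND NZ Ncl]; split=> [|z w hz hw|c z hz|z hz] /=.
- by rewrite raddf0.
- by rewrite opD; exact: ND.
- by rewrite opZ; exact: NZ.
apply: Ncl => d d0; have [v Nv zv] := hz _ (divr_gt0 d0 C0).
exists (A v) => //; rewrite -opB (le_trans (AC _))//.
by rewrite -ler_pdivlMl// mulrC.
Qed.

Variables (T : {linear H -> H}) (T' : {linear H' -> H'}) (A : {linear L -> L}).
Hypothesis TA : is_tensor_operator T T' A.

Lemma tensor_op_bounded : bounded_op A.
Proof. by apply: continuous_bounded_op; have [] := TA. Qed.

Lemma tensor_op_self_adjoint :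
  self_adjoint T -> self_adjoint T' -> self_adjoint A.
Proof.
move=> saT saT'; have [_ AT] := TA.
have [C C0 AC] := tensor_op_bounded.
(* For fixed [w] this is the kernel of a bounded functional of [z]. Two passes follow: first [w] is
   a simple tensor, then Hermitian symmetry exchanges the roles and [w] becomes arbitrary. *)
have sub w : csubspace [set z | inner L (A z) w = inner L z (A w)].
  have k0 : 0 < C * hn w + hn (A w) + 1.
    by rewrite ltr_wpDl// addr_ge0 ?mulr_ge0 ?hn_ge0// ltW.
  have -> : [set z | inner L (A z) w = inner L z (A w)] =
      [set z | inner L (A z) w - inner L z (A w) = 0].
    by apply/seteqP; split=> z /=; [move->; rewrite subrr|move=> /eqP; rewrite subr_eq0 => /eqP].
  apply: (csubspace_ker k0) => [z z'|c z|z].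
  - by rewrite opD !innerDl opprD addrACA.
  - by rewrite opZ !innerZl mulrBr.
  rewrite -(le_of_real cplx) -ge0_of_real//.
  rewrite (le_trans (ler_normB _ _))// mulrDl mulrDl !of_realD.
  rewrite -[leLHS]addr0 lerD//; last first.
    by rewrite -(of_real0 R cplx) le_of_real mul1r hn_ge0.
  apply: lerD; rewrite [leLHS](ge0_of_real (normr_ge0 _)) le_of_real.
    by rewrite (le_trans (re_norm_inner_le _ _))// mulrAC ler_wpM2r ?hn_ge0.
  by rewrite mulrC re_norm_inner_le.
have simple w x y : inner L (A w) (tens L x y) = inner L w (A (tens L x y)).
  apply: (cspan_tens w (sub (tens L x y))) => x' y' /=.
  by rewrite !AT !inner_tens saT saT'.
move=> z w; apply: (cspan_tens z (sub w)) => x y /=.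
by rewrite innerC -simple -innerC.
Qed.

Lemma tensor_op_diagonalizes (e : nat -> H) (e' : nat -> H') (lam lam' : nat -> R) :
  nonincreasing_seq lam -> nonincreasing_seq lam' ->
  diagonalizes T [set n | 0 < lam n] e lam ->
  diagonalizes T' [set n | 0 < lam' n] e' lam' ->
  diagonalizes A [set i : nat * nat | 0 < lam i.1 /\ 0 < lam' i.2]
    (fun i => tens L (e i.1) (e' i.2)) (fun i => lam i.1 * lam' i.2).
Proof.
move=> ndl ndl' [eD el lfin Tspan] [eD' el' lfin' Tspan'].
have [_ AT] := TA.
split=> [[n m] [n' m'] /= [n0 m0] [n'0 m'0]|[n m] /= [n0 m0]|t t0|z N Nsub gN].
- rewrite inner_tens eD// eD'// xpair_eqE.
  by case: (n == n'); case: (m == m'); rewrite ?mulr1 ?mulr0.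
- split; first exact: mulr_gt0.
  have [[_ Te] [_ Te']] := (el n n0, el' m m0).
  by rewrite AT Te Te' tensZl tensZr scalerA of_realM.
(* A product at least [t] forces each factor above [t] divided by a bound of the other, so the pairs
   lie in a product of two finite sets. *)
- have l0 : 0 < `|lam 0| + 1 by rewrite ltr_wpDl.
  have l'0 : 0 < `|lam' 0| + 1 by rewrite ltr_wpDl.
  have lE n : lam n <= `|lam 0| + 1.
    by rewrite (le_trans (ndl 0%N n _))// (le_trans (ler_norm _))// lerDl.
  have l'E n : lam' n <= `|lam' 0| + 1.
    by rewrite (le_trans (ndl' 0%N n _))// (le_trans (ler_norm _))// lerDl.
  apply: sub_finite_set (finite_setX (lfin _ (divr_gt0 t0 l'0))
    (lfin' _ (divr_gt0 t0 l0))) => -[n m] /= [[n0 m0] tl].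
  split; split=> //=; rewrite ler_pdivrMr// (le_trans tl)//.
    by rewrite ler_pM2l.
  by rewrite mulrC ler_pM2l.
(* The preimage of [N] under [A] is a closed subspace, so [z] may be a simple tensor; fixing one
   factor at a time then replaces [T x] and [T' y] by eigenvectors. *)
apply: (cspan_tens z (csubspace_preimage tensor_op_bounded Nsub)) => x y /=.
rewrite AT.
apply: (Tspan x _ (csubspace_tensl _ Nsub)) => _ [n n0 <-] /=.
apply: (Tspan' y _ (csubspace_tensr _ Nsub)) => _ [m m0 <-] /=.
by apply: gN; exists (n, m).
Qed.

Lemma tensor_op_compact_nonneg :
  compact_nonneg_sa T -> compact_nonneg_sa T' -> compact_nonneg_sa A.
Proof.
move=> cT cT'; have [[_ saT _] [_ saT' _]] := (cT, cT').
have [e eP] := eigval_seq_diagonalizes cT.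
have [e' eP'] := eigval_seq_diagonalizes cT'.
have [[ndl _ _] [ndl' _ _]] := (eigval_seqP cT, eigval_seqP cT').
apply: (diagonal_op_compact_nonneg (tensor_op_self_adjoint saT saT')
  (tensor_op_diagonalizes ndl ndl' eP eP')).
exact: tensor_op_bounded.
Qed.

Lemma tensor_counting_function t : 0 < t ->
  compact_nonneg_sa T -> compact_nonneg_sa T' ->
  counting_function A t =
  (#|` fset_set [set i : nat * nat | (0 < eigval_seq T i.1 /\ 0 < eigval_seq T' i.2) /\
     t < eigval_seq T i.1 * eigval_seq T' i.2]|)%:R.
Proof.
move=> t0 cT cT'; have cA := tensor_op_compact_nonneg cT cT'.
have [e eP] := eigval_seq_diagonalizes cT.
have [e' eP'] := eigval_seq_diagonalizes cT'.
have [[ndl _ _] [ndl' _ _]] := (eigval_seqP cT, eigval_seqP cT').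
exact: (counting_functionE cA (tensor_op_diagonalizes ndl ndl' eP eP')).
Qed.

End Tensor.

(** * Real analysis *)

Section RealAnalysis.
Variable R : realType.

Lemma near_at_right0 (P : R -> Prop) :
  (\forall t \near 0^'+, P t) <-> exists2 d, 0 < d & forall t, 0 < t -> t < d -> P t.
Proof.
split=> [[d /= d0 dP]|[d d0 dP]].
  exists d => // t t0 td; apply: dP => //=.
  by rewrite sub0r normrN gtr0_norm.
exists d => // t /=; rewrite sub0r normrN => td t0; apply: dP => //.
by rewrite (le_lt_trans (ler_norm _)).
Qed.

(** The logarithmic derivative of the product is (u (ln phi)'(u) + eps) / u, eventually positive
    because u (ln phi)'(u) tends to zero. *)
Lemma slowly_varying_powR_ndecr (phi : R -> R) (eps : R) : 0 < eps ->
  smooth_slowly_varying phi ->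
  exists2 tau0, 0 < tau0 & forall u v, tau0 <= u -> u <= v ->
    phi u * u `^ eps <= phi v * v `^ eps.
Proof.
move=> eps0 [[phi0 _ _] phi_C2 /cvgrPdist_lt/(_ eps eps0)[M [_ hM]] _].
pose tau0 := Num.max M 0 + 1.
have tau00 : 0 < tau0 by rewrite ltr_wpDl// le_max lexx orbT.
have Mtau0 : M < tau0 by rewrite ltr_pwDr// le_max lexx.
pose h : R -> R := (@ln R \o phi) + (eps \*: @ln R).
have hd (u : R) : 0 < u -> is_derive u 1 h ((@ln R \o phi)^`()%classic u + eps * u^-1).
  move=> u0; have [dphi _ _] := phi_C2 _ u0.
  apply: is_deriveD.
    rewrite derive1E; apply: derivableP.
    have /(@ex_derive _ _ _ _ _ _ _) := is_derive1_comp (is_derive1_ln (phi0 _ u0)) (derivableP dphi).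
    by [].
  by apply: is_deriveZ; exact: is_derive1_ln.
exists tau0 => // u v tu uv.
have v0 : 0 < v by rewrite (lt_le_trans tau00)// (le_trans tu).
have u0 : 0 < u by rewrite (lt_le_trans tau00).
have hE w : 0 < w -> phi w * w `^ eps = expR (h w).
  by move=> w0; rewrite /h fctE expRD /= lnK ?posrE ?phi0// /powR gt_eqF.
rewrite !hE// ler_expR.
apply: (@ger0_derive1_ndecry _ h tau0) => //.
- move=> x; rewrite in_itv/= andbT => xt.
  by have [] := hd x (lt_trans tau00 xt).
- move=> x; rewrite in_itv/= andbT => xt.
  have x0 := lt_trans tau00 xt.
  have [_ dE] := hd x x0; rewrite derive1E dE.
  have /= := hM x (lt_trans Mtau0 xt).
  rewrite sub0r normrN ltr_norml => /andP[+ _].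
  rewrite -(pmulr_rge0 _ x0) mulrDr mulrCA mulfV ?gt_eqF// mulr1.
  by move=> /ltW; rewrite lerNl -subr_ge0 opprK addrC.
- apply: derivable_within_continuous => x; rewrite in_itv/= andbT => xt.
  by have [] := hd x (lt_le_trans tau00 xt).
Qed.

Lemma periodic_bounds (s : R -> R) per : continuous s -> (forall x, 0 < s x) ->
  has_period s per ->
  exists m M, 0 < m /\ forall x, m <= s x <= M.
Proof.
move=> sc s0 [per0 sper].
have wc : {within `[0, per], continuous s} by exact: continuous_subspaceT.
have [a _ hmax] := EVT_max (ltW per0) wc.
have [b _ hmin] := EVT_min (ltW per0) wc.
suff red x : exists2 y, y \in `[0, per] & s x = s y.
  exists (s b), (s a); split=> // x; have [y yper ->] := red x.
  by rewrite hmin// hmax.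
pose n := Num.floor (x / per).
have /andP[n1 n2] : n%:~R <= x / per < (n + 1)%:~R.
  exact: floor_itv.
exists (x - n%:~R * per).
  rewrite in_itv /= subr_ge0 -ler_pdivlMr// n1 /= lerBlDr.
  have -> : per + n%:~R * per = (n + 1)%:~R * per by rewrite intrD mulrDl mul1r addrC.
  by rewrite -ler_pdivrMr// ltW.
case: n {n1 n2} => k.
  have -> : x = x - (Posz k)%:~R * per + per *+ k.
    by rewrite -mulr_natl subrK.
  by rewrite periodicn//; congr s; rewrite -mulr_natl addrK.
by rewrite NegzE mulrNz mulNr opprK mulr_natl periodicn.
Qed.

(* The telescoping bound behind the convergence of [\sum_k k `^ (- (1 + a))]. *)
Lemma powRN_diff (a x : R) : 0 < a -> 0 < x ->
  a * (x + 1) `^ (- (1 + a)) <= x `^ (- a) - (x + 1) `^ (- a).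
Proof.
move=> a0 x0; set y := x + 1.
have y0 : 0 < y by rewrite addr_gt0.
have y1 : - 1 < - y^-1 by rewrite ltrN2 invf_lt1// ltrDr.
(* As x = y (1 - 1 / y), this is ln (1 + z) <= z; the bound 1 + z <= exp z finishes the estimate. *)
have lnx : ln x <= ln y - y^-1.
  have -> : x = y * (1 + - y^-1) by rewrite mulrDr mulr1 mulrN mulfV ?gt_eqF// addrK.
  rewrite lnM ?posrE//; last by rewrite -ltrBlDl sub0r.
  by rewrite lerD2l le_ln1Dx.
have yE : y `^ (- (1 + a)) = y `^ (- a) * y^-1.
  have -> : - (1 + a) = - a - 1 by rewrite opprD addrC.
  by rewrite powRB ?(gt_eqF y0) ?implybT// powRr1 ?ltW.
rewrite yE mulrCA lerBrDr -[X in _ + X <= _]mulr1 -mulrDr.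
apply: (@le_trans _ _ (y `^ (- a) * expR (a * y^-1))).
  by rewrite ler_wpM2l ?powR_ge0// addrC expR_ge1Dx.
rewrite /powR !gt_eqF// -expRD ler_expR !mulNr -mulrN -mulrN -mulrDr ler_pM2l//.
by rewrite lerNr opprD opprK.
Qed.

Lemma cvg_series_powRN (r : R) : 1 < r -> cvgn (series (fun k => k.+1%:R `^ (- r))).
Proof.
move=> r1; pose a := r - 1; have a0 : 0 < a by rewrite subr_gt0.
apply: nondecreasing_is_cvgn.
  by apply: nondecreasing_series => k _ _; exact: powR_ge0.
exists (1 + a^-1) => _ [n _ <-].
suff h m : \sum_(0 <= k < m.+1) k.+1%:R `^ (- r) <= 1 + a^-1 * (1 - m.+1%:R `^ (- a)).
  rewrite /series /=; case: n => [|n].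
    by rewrite big_geq// addr_ge0// invr_ge0 ltW.
  by rewrite (le_trans (h n))// lerD2l ler_piMr ?invr_ge0 ?(ltW a0)// gerBl powR_ge0.
elim: m => [|m IH].
  by rewrite big_nat1 powR1 subrr mulr0 addr0.
rewrite big_nat_recr//= (le_trans (lerD IH (lexx _)))//.
have := @powRN_diff a m.+1%:R a0 (ltr0Sn _ _).
have -> : m.+1%:R + 1 = m.+2%:R :> R by rewrite natr1.
have -> : - (1 + a) = - r by rewrite /a subrKC.
rewrite -ler_pdivlMl// => h.
rewrite -addrA lerD2l -lerBrDl -mulrBr (le_trans h)// ler_pM2l ?invr_gt0//.
by lra.
Qed.

(** Dominated convergence for series. The threshold [d] does not depend on the number [M] of terms,
    which can therefore be chosen after [t]: the exact counting formula has a length depending on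
    [t]. *)
Lemma tannery (z : nat -> R -> R) (c : nat -> R) d0 :
  0 < d0 -> cvgn (series c) ->
  (forall k t, 0 < t -> t < d0 -> `|z k t| <= c k) ->
  (forall k e, 0 < e ->
    exists2 d, 0 < d & forall t, 0 < t -> t < d -> `|z k t| <= e) ->
  forall e, 0 < e -> exists2 d, 0 < d & forall t, 0 < t -> t < d ->
    forall M, `|\sum_(0 <= k < M) z k t| <= e.
Proof.
move=> d00 cc zc z0 e e0.
have e20 : 0 < e / 2 by rewrite divr_gt0.
have [K hK] : exists K, forall M, (K <= M)%N -> \sum_(K <= k < M) c k <= e / 2.
  have /cauchy_cvgP/cauchy_seriesP/(_ _ e20)[[P Q] /= [[K1 _ hP] [K2 _ hQ]] PQ] := cc.
  exists (maxn K1 K2) => M KM; apply: (le_trans (ler_norm _)); apply: ltW.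
  apply: (PQ (maxn K1 K2, M)); split=> /=.
    by apply: hP; rewrite /= leq_maxl.
  by apply: hQ; rewrite /= (leq_trans (leq_maxr _ _) KM).
have K0 : 0 < e / 2 / K.+1%:R by rewrite divr_gt0.
have /(_ K)[d d_gt0 hd] n : exists2 d, 0 < d & forall k t, (k < n)%N ->
    0 < t -> t < d -> `|z k t| <= e / 2 / K.+1%:R.
  elim: n => [|n [d d_gt0 hd]]; first by exists 1.
  have [d' d'_gt0 hd'] := z0 n _ K0.
  exists (Num.min d d'); first by rewrite lt_min d_gt0.
  move=> k t; rewrite ltnS leq_eqVlt => /predU1P[->|kn] t0; rewrite lt_min => /andP[td td'].
    exact: hd'.
  exact: hd.
exists (Num.min d d0); first by rewrite lt_min d_gt0.
move=> t t0; rewrite lt_min => /andP[td td0] M.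
have head m : (m <= K)%N -> `|\sum_(0 <= k < m) z k t| <= e / 2.
  move=> mK; rewrite (le_trans (ler_norm_sum _ _ _))//.
  apply: (@le_trans _ _ (\sum_(0 <= k < m) e / 2 / K.+1%:R)).
    rewrite big_nat [leRHS]big_nat; apply: ler_sum => k /andP[_ km].
    by apply: hd => //; exact: leq_trans mK.
  rewrite sumr_const_nat subn0 -[leLHS]mulr_natr -mulrA ger_pMr//.
  by rewrite mulrC ler_pdivrMr// mul1r ler_nat (leq_trans mK).
have [MK|KM] := leqP M K.
  by rewrite (le_trans (head _ MK))// ler_pdivrMr// ler_pMr// ler1n.
rewrite (big_cat_nat _ (n := K))//=; last exact: ltnW.
rewrite (le_trans (ler_normD _ _))// (splitr e) lerD ?head//.
rewrite (le_trans (ler_norm_sum _ _ _))// (le_trans _ (hK M (ltnW KM)))//.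
by apply: ler_sum => k _; exact: zc.
Qed.

End RealAnalysis.

(** * Summability of powers of the eigenvalues *)

Section Summability.
Variable R : realType.

Lemma powRV (t x : R) : 0 <= t -> t^-1 `^ x = t `^ (- x).
Proof. by move=> t0; rewrite -powR_inv1// -powRrM mulN1r. Qed.

Lemma exists_lt_of_finite (mu : nat -> R) d : 0 < d ->
  (forall t, 0 < t -> finite_set [set n | t < mu n]) -> exists k, mu k < d.
Proof.
move=> d0 mufin; apply: contrapT => /forallNP h.
have d20 : 0 < d / 2 by rewrite divr_gt0.
apply: infinite_nat; apply: sub_finite_set (mufin _ d20) => n _ /=.
apply: (@lt_le_trans _ _ d); first by rewrite ltr_pdivrMr// ltr_pMr// ltr1n.
by rewrite leNgt; exact/negP/h.
Qed.

(** At level [mu k / 2] at least [k.+1] terms are counted, so mu k = O((k + 1)^(- p')), and its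
    power [q] is summable because p' q > 1. Halving makes the strict inequality hold at [k]
    itself. *)
Lemma cvg_series_powR_of_counting (mu : nat -> R) p' q C d :
  nonincreasing_seq mu -> (forall n, 0 <= mu n) ->
  (forall t, 0 < t -> finite_set [set n | t < mu n]) ->
  0 < p' -> 1 < p' * q -> 0 <= C -> 0 < d ->
  (forall t, 0 < t -> t < d ->
     (#|` fset_set [set n | (t < mu n)%R]|)%:R <= C * t `^ (- p'^-1)) ->
  cvgn (series (fun k => mu k `^ q)).
Proof.
move=> mu_dec mu0 mufin p'0 p'q C0 d0 hC.
have q0 : 0 < q by rewrite -(pmulr_rgt0 _ p'0) (lt_trans ltr01).
have [k0 hk0] := exists_lt_of_finite d0 mufin.
pose r := p' * q.
(* The first summand serves [k >= k0], where the counting bound is available; the second absorbs the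
   finitely many earlier terms. *)
pose C4 := 2 `^ q * C `^ r + mu 0 `^ q * k0.+1%:R `^ r.
have C40 : 0 <= C4 by rewrite addr_ge0// mulr_ge0// powR_ge0.
apply: (@series_le_cvg _ _ (C4 *: (fun k => k.+1%:R `^ (- r)))).
- by move=> n; exact: powR_ge0.
- by move=> n; rewrite /= mulr_ge0// powR_ge0.
- move=> k; rewrite fctE /GRing.scale /=.
  have [kk0|k0k] := ltnP k k0.
    apply: (@le_trans _ _ (mu 0 `^ q * k0.+1%:R `^ r * k.+1%:R `^ (- r))).
      apply: (@le_trans _ _ (mu 0 `^ q)).
        by apply: ge0_ler_powR; rewrite ?nnegrE ?mu0 ?(ltW q0)//; exact: mu_dec.
      rewrite -mulrA ler_peMr ?powR_ge0// powRN ler_pdivlMr ?powR_gt0// mul1r.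
      apply: ge0_ler_powR; rewrite ?nnegrE// ?ler_nat ?ltnS ?(ltnW kk0)//.
      by rewrite (le_trans ler01)// ltW.
    by rewrite ler_wpM2r ?powR_ge0// lerDr mulr_ge0 ?powR_ge0.
  have [->|muk0] := eqVneq (mu k) 0.
    by rewrite powR0 ?gt_eqF// mulr_ge0// powR_ge0.
  have mukp : 0 < mu k by rewrite lt0r muk0 mu0.
  have mu20 : 0 < mu k / 2 by rewrite divr_gt0.
  have mu2 : mu k / 2 < mu k by rewrite ltr_pdivrMr// ltr_pMr// ltr1n.
  have mud : mu k / 2 < d by rewrite (lt_trans mu2)// (le_lt_trans (mu_dec _ _ k0k)).
  have kC : k.+1%:R <= C * (mu k / 2) `^ (- p'^-1).
    rewrite (le_trans _ (hC _ mu20 mud))// ler_nat.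
    apply: leq_card_fset_set; first exact: mufin.
    apply: subset_card_le => n /=; rewrite ltnS => nk.
    by rewrite (lt_le_trans mu2)//; exact: mu_dec.
  have muC : mu k / 2 <= (C / k.+1%:R) `^ p'.
    have -> : mu k / 2 = ((mu k / 2) `^ (p'^-1)) `^ p'.
      by rewrite -powRrM mulVf ?gt_eqF// powRr1// ltW.
    apply: ge0_ler_powR; rewrite ?nnegrE ?powR_ge0 ?divr_ge0 ?(ltW p'0)//.
    rewrite ler_pdivlMr// mulrC -ler_pdivlMr ?powR_gt0//.
    by rewrite -powRN.
  apply: (@le_trans _ _ (2 `^ q * C `^ r * k.+1%:R `^ (- r))); last first.
    by rewrite ler_wpM2r ?powR_ge0// lerDl mulr_ge0 ?powR_ge0.
  have -> : mu k = 2 * (mu k / 2) by rewrite mulrC mulfVK.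
  rewrite powRM// ?(ltW mu20)// -mulrA ler_wpM2l ?powR_ge0//.
  rewrite -powRV// -powRM// ?invr_ge0//.
  rewrite [leRHS]powRrM; apply: ge0_ler_powR; rewrite ?nnegrE ?powR_ge0 ?(ltW q0) ?(ltW mu20)//.
- by apply: is_cvg_seriesZ; exact: cvg_series_powRN.
Qed.

(** Passes from an absolute error of the quotient to a relative error; this is where a positive
    lower bound of [s_star] enters. *)
Lemma norm_sub_ratio_le (a g st e kappa : R) : 0 < e -> 0 < g -> 0 < kappa ->
  kappa <= st -> `|a / g - st| <= e * kappa -> `|a - g * st| <= e * `|g * st|.
Proof.
move=> e0 g0 kappa0 kst h; have st0 : 0 < st by exact: lt_le_trans kst.
have -> : a - g * st = (a / g - st) * g by field; rewrite gt_eqF.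
rewrite !normrM (gtr0_norm g0) (gtr0_norm st0) [g * st]mulrC mulrA.
by rewrite ler_pM2r// (le_trans h)// ler_pM2l.
Qed.

End Summability.

(** * Rescaled counting functions and their sum *)

Section Scaling.
Variable R : realType.
Variables (phi s N : R -> R) (p q m M Lam : R).
Hypotheses (q0 : 0 < q) (qp : q < p^-1).
Hypothesis phiP : smooth_slowly_varying phi.
Hypotheses (m0 : 0 < m) (sP : forall x, m <= s x <= M).
Hypotheses (N0 : forall t, 0 <= N t) (Lam0 : 0 < Lam).
Hypothesis Nmono : forall t u, 0 < t -> t <= u -> N u <= N t.
Hypothesis NLam : forall t, Lam <= t -> N t = 0.
Hypothesis Nasym : N ~_ (0^'+) almost_regular phi s p.

Definition gauge t := phi t^-1 * t `^ (- p^-1).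

Let eps := p^-1 - q.
Let eps0 : 0 < eps. Proof. by rewrite subr_gt0. Qed.
Let M0 : 0 < M.
Proof. by have /andP[h h'] := sP 0; exact: lt_le_trans (le_trans h h'). Qed.
Let phi0 x : 0 < x -> 0 < phi x. Proof. by have [[h _ _] _ _ _] := phiP; exact: h. Qed.

Lemma gauge_gt0 t : 0 < t -> 0 < gauge t.
Proof. by move=> t0; rewrite mulr_gt0 ?powR_gt0// phi0// invr_gt0. Qed.

Lemma almost_regularE (s' : R -> R) t : almost_regular phi s' p t = gauge t * s' (ln t^-1).
Proof. by rewrite /almost_regular /gauge powRN mulrAC. Qed.

Lemma counting_near e : 0 < e -> exists2 d, 0 < d & forall t, 0 < t -> t < d ->
  `|N t - gauge t * s (ln t^-1)| <= e * (gauge t * s (ln t^-1)).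
Proof.
move=> e0; move/eqaddoP: Nasym => /(_ e e0)/near_at_right0[d d0 hd].
exists d => // t t0 td; have := hd t t0 td.
rewrite !fctE almost_regularE [X in _ <= _ * X]ger0_norm//.
rewrite mulr_ge0 ?(ltW (gauge_gt0 t0))//.
by have /andP[h _] := sP (ln t^-1); rewrite (le_trans (ltW m0)).
Qed.

Lemma slowly_varying_near c e : 0 < c -> 0 < e ->
  exists2 d, 0 < d & forall t, 0 < t -> t < d ->
    `|phi (c * t^-1) / phi t^-1 - 1| <= e.
Proof.
move=> c0 e0; have [[_ _ /(_ c c0)/cvgrPdist_lt/(_ e e0)[K [_ hK]]] _ _ _] := phiP.
exists (Num.max K 0 + 1)^-1.
  by rewrite invr_gt0 ltr_wpDl// le_max lexx orbT.
move=> t t0 td; rewrite distrC ltW//; apply: hK.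
have K1 : 0 < Num.max K 0 + 1 by rewrite ltr_wpDl// le_max lexx orbT.
rewrite (@le_lt_trans _ _ (Num.max K 0 + 1))//.
  by rewrite (@le_trans _ _ (Num.max K 0))// ?lerDl// le_max lexx.
by rewrite -[X in X < _]invrK ltf_pV2 ?posrE ?invr_gt0.
Qed.

(** The dominating bound. [N] is first bounded on the whole half-line by t^(- q) times a
    nondecreasing factor; rescaling [t] by [mu] yields mu^q, and the factor is compared with its
    value at [t^-1] by monotonicity and one use of slow variation with the fixed ratio [B]. *)
Lemma counting_scaled_le B : 1 <= B ->
  exists2 C, 0 < C & exists2 d, 0 < d & forall t mu, 0 < t -> t < d ->
    0 < mu -> mu <= B -> N (t / mu) <= C * mu `^ q * gauge t.
Proof.
move=> B1; have B0 : 0 < B by rewrite (lt_le_trans ltr01).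
have [tau0 tau00 Phi_ndecr] := slowly_varying_powR_ndecr eps0 phiP.
pose Phi u := phi u * u `^ eps.
have [d1 d10 hd1] := counting_near ltr01.
have [d2 d20 hd2] := slowly_varying_near B0 ltr01.
pose tau1 := Num.max tau0 (d1^-1 + 1).
have tau10 : 0 < tau1 by rewrite lt_max tau00.
have Phi0 u : 0 < u -> 0 < Phi u by move=> u0; rewrite mulr_gt0 ?phi0 ?powR_gt0.
have gaugeE t : 0 < t -> gauge t = t `^ (- q) * Phi t^-1.
  move=> t0; rewrite /Phi powRV ?ltW// mulrCA -powRD ?(gt_eqF t0) ?implybT//.
  by rewrite /gauge /eps opprB addKr.
(* The first summand is for [t <= tau1^-1], where the asymptotics holds within a factor 2; the
   second for [t] between [tau1^-1] and [Lam], where [N t <= N tau1^-1]. Above [Lam] nothing is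
   counted. *)
pose C1 := 2 * M + N tau1^-1 * Lam `^ q / Phi tau1.
have C10 : 0 < C1.
  rewrite ltr_pwDl ?mulr_gt0// divr_ge0 ?(ltW (Phi0 _ tau10))//.
  by rewrite mulr_ge0// powR_ge0.
have Nle t : 0 < t -> N t <= C1 * t `^ (- q) * Phi (Num.max t^-1 tau1).
  move=> t0; have [tt|tt] := leP tau1 t^-1.
    have td1 : t < d1.
      rewrite -ltf_pV2 ?posrE// (lt_le_trans _ tt)// lt_max orbC.
      by rewrite ltrDl ltr01.
    have /andP[sm sM] := sP (ln t^-1).
    have := hd1 t t0 td1; rewrite mul1r ler_norml => /andP[_].
    rewrite lerBlDr => /le_trans; apply.
    rewrite -mulr2n -mulr_natl -mulrA -gaugeE// mulrA mulrAC.
    rewrite ler_wpM2r ?(ltW (gauge_gt0 t0))//.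
    rewrite (@le_trans _ _ (2 * M))// ?ler_wpM2l// lerDl.
    by rewrite divr_ge0 ?(ltW (Phi0 _ tau10))// mulr_ge0// powR_ge0.
  have [Lt|tL] := leP Lam t.
    by rewrite NLam// mulr_ge0 ?(ltW (Phi0 _ tau10))// mulr_ge0 ?powR_ge0 ?ltW.
  apply: (@le_trans _ _ (N tau1^-1)).
    apply: Nmono; rewrite ?invr_gt0//.
    by rewrite -[leRHS]invrK lef_pV2 ?posrE ?invr_gt0// ltW.
  apply: (@le_trans _ _ (N tau1^-1 * Lam `^ q / Phi tau1 * t `^ (- q) * Phi tau1)).
    rewrite mulrAC mulfVK ?gt_eqF ?Phi0// -mulrA ler_peMr//.
    rewrite powRN ler_pdivlMr ?powR_gt0// mul1r.
    by apply: ge0_ler_powR; rewrite ?nnegrE ?(ltW q0) ?(ltW t0) ?(ltW Lam0) ?(ltW tL).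
  rewrite ler_wpM2r ?(ltW (Phi0 _ tau10))// ler_wpM2r ?powR_ge0//.
  by rewrite lerDr mulr_ge0// ltW.
exists (C1 * (2 * B `^ eps)); first by rewrite !mulr_gt0 ?powR_gt0.
exists (Num.min tau1^-1 d2); first by rewrite lt_min invr_gt0 tau10.
move=> t mu t0; rewrite lt_min => /andP[td1 td2] mu0 muB.
have tV0 : 0 < t^-1 by rewrite invr_gt0.
rewrite (le_trans (Nle _ (divr_gt0 t0 mu0)))// invf_div.
have tau1t : tau1 < t^-1 by rewrite -[tau1]invrK ltf_pV2 ?posrE ?invr_gt0.
have h1 : Phi (Num.max (mu / t) tau1) <= Phi (B * t^-1).
  apply: Phi_ndecr; first by rewrite le_max /tau1 le_max lexx orbT.
  rewrite ge_max ler_pM2r// muB (le_trans (ltW tau1t))// ler_peMl//.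
  exact: ltW.
have h2 : Phi (B * t^-1) <= 2 * B `^ eps * Phi t^-1.
  rewrite /Phi powRM ?(ltW B0) ?(ltW tV0)//.
  have -> : 2 * B `^ eps * (phi t^-1 * t^-1 `^ eps) =
    2 * phi t^-1 * (B `^ eps * t^-1 `^ eps) by ring.
  rewrite ler_wpM2r ?mulr_ge0 ?powR_ge0// -ler_pdivrMr ?phi0//.
  have := hd2 t t0 td2; rewrite ler_norml => /andP[_].
  by rewrite lerBlDr.
rewrite powRM ?invr_ge0 ?(ltW t0) ?(ltW mu0)// (powRV _ (ltW mu0)) opprK.
rewrite gaugeE//.
have -> : C1 * (2 * B `^ eps) * mu `^ q * (t `^ (- q) * Phi t^-1) =
   C1 * (t `^ (- q) * mu `^ q) * (2 * B `^ eps * Phi t^-1) by ring.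
rewrite ler_wpM2l// ?(le_trans h1)//.
by rewrite mulr_ge0 ?(ltW C10)// mulr_ge0 ?powR_ge0.
Qed.

Lemma counting_scaled_cvg mu e : 0 < mu -> 0 < e ->
  exists2 d, 0 < d & forall t, 0 < t -> t < d ->
    `|N (t / mu) / gauge t - s (ln t^-1 + ln mu) * mu `^ p^-1| <= e.
Proof.
move=> mu0 e0.
have K0 : 0 < 3 * (M * mu `^ p^-1) by rewrite !mulr_gt0// powR_gt0.
(* The 1 ensures [rho <= 2]. Of the three shares, two pay for the asymptotics of [N] multiplied by
   [rho], and one for [rho] itself. *)
pose e1 := Num.min 1 (e / (3 * (M * mu `^ p^-1))).
have e10 : 0 < e1 by rewrite lt_min ltr01 divr_gt0.
have [d1 d10 hd1] := counting_near e10.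
have [d2 d20 hd2] := slowly_varying_near mu0 e10.
exists (Num.min (d1 * mu) d2); first by rewrite lt_min mulr_gt0.
move=> t t0; rewrite lt_min => /andP[td1 td2].
have tmu0 : 0 < t / mu by rewrite divr_gt0.
have tmud : t / mu < d1 by rewrite ltr_pdivrMr.
have := hd1 _ tmu0 tmud; have := hd2 t t0 td2.
have tV0 : 0 < t^-1 by rewrite invr_gt0.
have lnE : ln (t / mu)^-1 = ln t^-1 + ln mu.
  by rewrite invf_div mulrC lnM.
set rho := phi (mu * t^-1) / phi t^-1.
have gE : gauge (t / mu) = rho * mu `^ p^-1 * gauge t.
  rewrite /gauge invf_div powRM ?invr_ge0 ?(ltW t0) ?(ltW mu0)//.
  rewrite (powRV _ (ltW mu0)) opprK /rho; field.
  by rewrite gt_eqF ?phi0.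
rewrite lnE gE; set S := s _.
have /andP[Sm SM] : m <= S <= M by exact: sP.
have g0 := gauge_gt0 t0; set g := gauge t in g0 *.
set P := mu `^ p^-1; have P0 : 0 < P by rewrite powR_gt0.
move=> hrho hN.
have rho2 : rho <= 2.
  move: hrho; rewrite ler_norml => /andP[_]; rewrite lerBlDr => /le_trans; apply.
  by rewrite -[leRHS](_ : 1 + 1 = 2)// lerD2r ge_min lexx.
have S0 : 0 <= S by rewrite (le_trans (ltW m0)).
have SP : S * P <= M * P by rewrite ler_wpM2r// ltW.
have SP0 : 0 <= S * P by rewrite mulr_ge0// ltW.
have h1 : `|N (t / mu) / g - rho * (S * P)| <= e1 * (2 * (M * P)).
  have -> : N (t / mu) / g - rho * (S * P) = (N (t / mu) - rho * P * g * S) / g.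
    by field; rewrite gt_eqF.
  rewrite normrM normfV (gtr0_norm g0) ler_pdivrMr// (le_trans hN)//.
  have -> : e1 * (rho * P * g * S) = e1 * (rho * (S * P)) * g by ring.
  rewrite ler_pM2r// ler_pM2l//.
  by rewrite (le_trans (ler_wpM2r SP0 rho2))// ler_pM2l.
have h2 : `|rho * (S * P) - S * P| <= e1 * (M * P).
  have -> : rho * (S * P) - S * P = (rho - 1) * (S * P) by ring.
  rewrite normrM (ger0_norm SP0); apply: ler_pM => //.
have e1K : e1 * (3 * (M * P)) <= e by rewrite -ler_pdivlMr// ge_min lexx orbT.
rewrite -(subrKA (rho * (S * P))) (le_trans (ler_normD _ _))//.
by rewrite (le_trans (lerD h1 h2))// (le_trans _ e1K)//; lra.
Qed.

Variable mu : nat -> R.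
Hypotheses (mu_dec : nonincreasing_seq mu) (mu0 : forall n, 0 <= mu n).
Hypothesis mu_sum : cvgn (series (fun k => mu k `^ q)).

Let B := mu 0 + 1.

Lemma s_star_term_ge0 tau k : 0 <= s_star_term s p mu tau k.
Proof.
rewrite /s_star_term; case: ifP => // _; rewrite mulr_ge0 ?powR_ge0//.
by have /andP[h _] := sP (tau + ln (mu k)); rewrite (le_trans (ltW m0)).
Qed.

(** The power 1 / p of [mu k] is split as eps + q; the part eps is bounded by its value at [B]. *)
Lemma s_star_term_le tau k :
  s_star_term s p mu tau k <= M * B `^ eps * mu k `^ q.
Proof.
have B0 : 0 <= B by rewrite addr_ge0.
have muB : mu k <= B by rewrite (le_trans (mu_dec (leq0n k)))// lerDl.
rewrite /s_star_term; case: ifP => muk; last first.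
  by rewrite !mulr_ge0 ?powR_ge0// ltW.
have -> : mu k `^ p^-1 = mu k `^ eps * mu k `^ q.
  by rewrite -powRD ?(gt_eqF muk) ?implybT// subrK.
rewrite mulrA ler_wpM2r ?powR_ge0//.
apply: ler_pM; rewrite ?powR_ge0//.
- by have /andP[h _] := sP (tau + ln (mu k)); rewrite (le_trans (ltW m0)).
- by have /andP[] := sP (tau + ln (mu k)).
- by apply: ge0_ler_powR; rewrite ?nnegrE ?(ltW eps0).
Qed.

Lemma cvg_s_star tau : cvgn (series (s_star_term s p mu tau)).
Proof.
apply: (@series_le_cvg _ _ ((M * B `^ eps) *: (fun k => mu k `^ q))).
- exact: s_star_term_ge0.
- by move=> n; rewrite /= !mulr_ge0 ?powR_ge0// ltW.
- exact: s_star_term_le.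
- exact: is_cvg_seriesZ.
Qed.

Lemma s_star_ge tau : 0 < mu 0 -> m * mu 0 `^ p^-1 <= s_star s p mu tau.
Proof.
move=> mu00; apply: (@le_trans _ _ (series (s_star_term s p mu tau) 1%N)).
  rewrite /series /= big_nat1 /s_star_term mu00 ler_wpM2r ?powR_ge0//.
  by have /andP[] := sP (tau + ln (mu 0)).
apply: nondecreasing_cvgn_le; last exact: cvg_s_star.
by apply: nondecreasing_series => k _ _; exact: s_star_term_ge0.
Qed.

Lemma product_counting_asymptotics (NA : R -> R) :
  (forall t, 0 < t -> exists K, forall n, (K <= n)%N ->
     NA t = \sum_(0 <= k < n) (if 0 < mu k then N (t / mu k) else 0)) ->
  NA ~_ (0^'+) almost_regular phi (s_star s p mu) p.
Proof.
move=> NAE; apply/eqaddoP => e e0; apply/near_at_right0.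
have [mu00|mu00] := ltP 0 (mu 0); last first.
  have muk k : (0 < mu k) = false.
    by apply/negbTE; rewrite -leNgt (le_trans _ mu00)//; exact: mu_dec.
  exists 1 => // t t0 _; have [K hK] := NAE t t0.
  rewrite !fctE (hK K)// big1 => [|k _]; last by rewrite muk.
  have st0 : s_star s p mu (ln t^-1) = 0.
    have sE : series (s_star_term s p mu (ln t^-1)) = cst 0.
      apply/funext => n; rewrite /series /= big1// => k _.
      by rewrite /s_star_term muk.
    by rewrite /s_star sE lim_cst.
  by rewrite almost_regularE st0 mulr0 subr0 normr0 mulr0.
have B1 : 1 <= B by rewrite lerDr.
have [C C0 [d0 d00 hC]] := counting_scaled_le B1.
pose z k t := (if 0 < mu k then N (t / mu k) / gauge t else 0) -
  s_star_term s p mu (ln t^-1) k.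
have cc : cvgn (series ((C + M * B `^ eps) *: (fun k => mu k `^ q))).
  exact: is_cvg_seriesZ.
have zle k t : 0 < t -> t < d0 -> `|z k t| <= (C + M * B `^ eps) * mu k `^ q.
  move=> t0 td; rewrite (le_trans (ler_normB _ _))// mulrDl lerD//; last first.
    by rewrite ger0_norm ?s_star_term_ge0 ?s_star_term_le.
  case: ifP => muk; last by rewrite normr0 mulr_ge0 ?powR_ge0// ltW.
  rewrite ger0_norm ?divr_ge0 ?(ltW (gauge_gt0 t0))// ler_pdivrMr ?gauge_gt0//.
  by apply: hC => //; rewrite (le_trans (mu_dec (leq0n k)))// lerDl.
have z0 k e' : 0 < e' ->
    exists2 d, 0 < d & forall t, 0 < t -> t < d -> `|z k t| <= e'.
  move=> e'0; rewrite /z /s_star_term; case: (boolP (0 < mu k)) => muk.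
    exact: counting_scaled_cvg.
  by exists 1 => // t _ _; rewrite subrr normr0 ltW.
pose kappa := m * mu 0 `^ p^-1.
have kappa0 : 0 < kappa by rewrite mulr_gt0 ?powR_gt0.
(* The tolerance [e * kappa] becomes the relative error [e], since [s_star] is at least [kappa]. *)
have [d d_gt0 hd] := tannery d00 cc zle z0 (mulr_gt0 e0 kappa0).
exists d => // t t0 td.
have g0 := gauge_gt0 t0; have [K hK] := NAE t t0.
rewrite !fctE almost_regularE.
set st := s_star _ _ _ _.
have st_ge : kappa <= st by exact: s_star_ge.
apply: (norm_sub_ratio_le e0 g0 kappa0 st_ge).
apply/ler_addgt0Pl => e' e'0.
have /cvgrPdist_le/(_ e' e'0)[K' _ hK'] := @cvg_s_star (ln t^-1).
(* Long enough for the finite counting formula and for the partial sum of [s_star] to be within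
   [e']. Both thresholds depend on [t]. *)
pose n := maxn K K'.
have nK : (K <= n)%N by rewrite leq_maxl.
have := hK' n (leq_maxr _ _); rewrite -/(s_star s p mu (ln t^-1)) -/st => h1.
have := hd t t0 td n; rewrite /z sumrB => h2.
have h3 : NA t / gauge t = \sum_(0 <= k < n) (if 0 < mu k then N (t / mu k) / gauge t else 0).
  rewrite (hK n nK) mulr_suml; apply: eq_bigr => k _.
  by case: ifP => // _; rewrite mul0r.
rewrite -h3 in h2.
rewrite -(subrKA (series (s_star_term s p mu (ln t^-1)) n)) (le_trans (ler_normD _ _))//.
by rewrite addrC lerD// distrC.
Qed.

End Scaling.

(** The pairs are split by their second index. The columns from [n] on are empty, since even the
    largest [lam] gives a product at most [t]. *)
Lemma card_product_pairs (R : realType) (lam mu : nat -> R) t n :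
  nonincreasing_seq lam -> (forall k, 0 <= mu k) ->
  (forall u, 0 < u -> finite_set [set j | u < lam j]) -> 0 < t ->
  (forall k, (n <= k)%N -> lam 0 * mu k <= t) ->
  (#|` fset_set [set i : nat * nat | (0 < lam i.1 /\ 0 < mu i.2) /\
     (t < lam i.1 * mu i.2)%R]|)%:R =
  \sum_(0 <= k < n) (if 0 < mu k then
     (#|` fset_set [set j | (t / mu k < lam j)%R]|)%:R else 0) :> R.
Proof.
move=> lam_dec mu0 lamfin t0 tail.
pose F k := [set i : nat * nat | [/\ i.2 = k, 0 < mu k & t < lam i.1 * mu k]].
have FE k : 0 < mu k -> F k = (fun j => (j, k)) @` [set j | t / mu k < lam j].
  move=> muk; apply/seteqP; split=> [[j k'] [/= -> _ tl]|_ [j /= tl <-]].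
    by exists j => //=; rewrite ltr_pdivrMr.
  by split=> //=; rewrite -ltr_pdivrMr.
have F0 k : ~~ (0 < mu k) -> F k = set0.
  by move=> muk; apply/seteqP; split=> // i [_ muk' _]; rewrite muk' in muk.
have Ffin k : finite_set (F k).
  have [muk|muk] := boolP (0 < mu k); last by rewrite F0.
  by rewrite FE//; apply: finite_image; apply: lamfin; exact: divr_gt0.
have Ftriv : trivIset setT F.
  by move=> k k' _ _ [i [[<- _ _] [<- _ _]]].
have -> : [set i : nat * nat | (0 < lam i.1 /\ 0 < mu i.2) /\ t < lam i.1 * mu i.2] =
    \big[setU/set0]_(k < n) F k.
  rewrite -bigcup_mkord; apply/seteqP; split=> [[j k] /= [[l0 m0] tl]|[j k] [k' /= _ [/= -> m0 tl]]].
    exists k => //=; rewrite ltnNge; apply/negP => /tail.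
    by apply/negP; rewrite -ltNge (lt_le_trans tl)// ler_pM2r//; exact: lam_dec.
  by split=> //; split=> //; rewrite -(pmulr_lgt0 _ m0) (lt_trans t0).
rewrite -trivIset_sum_card// natr_sum big_mkord; apply: eq_bigr => k _.
case: ifPn => muk; last by rewrite F0// fset_set0 cardfs0.
rewrite FE// fset_set_image; last by apply: lamfin; exact: divr_gt0.
by rewrite card_imfset// => i j [].
Qed.

Lemma eigval_seq_finite (R : realType) (cplx : bool) (H : hilbert R cplx)
    (T : {linear H -> H}) t :
  compact_nonneg_sa T -> 0 < t -> finite_set [set n | t < eigval_seq T n].
Proof.
move=> cT t0; have [e [_ _ lfin _]] := eigval_seq_diagonalizes cT.
apply: sub_finite_set (lfin _ t0) => n /= tn.
by split; [exact: lt_trans tn|exact: ltW].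
Qed.

Theorem theorem1 (R : realType) (cplx : bool)
    (H H' : hilbert R cplx) (L : hilbert_tensor H H')
    (T : {linear H -> H}) (T' : {linear H' -> H'}) (A : {linear L -> L})
    (p p' per : R) (phi s : R -> R) :
  compact_nonneg_sa T -> compact_nonneg_sa T' -> is_tensor_operator T T' A ->
  0 < p -> p < p' ->
  smooth_slowly_varying phi ->
  continuous s -> (forall tau, 0 < s tau) -> has_period s per ->
  counting_function T ~_ (0^'+) almost_regular phi s p ->
  counting_function T' =O_ (0^'+) (fun t : R => (t `^ (- p'^-1))%R) ->
  [/\ compact_nonneg_sa A,
      forall tau, cvgn (series (s_star_term s p (eigval_seq T') tau)),
      has_period (s_star s p (eigval_seq T')) per &
      counting_function A ~_ (0^'+)
        almost_regular phi (s_star s p (eigval_seq T')) p].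
Proof.
move=> cT cT' TA p0 pp' phiP sc s0 sper Nasym N'O.
have p'0 := lt_trans p0 pp'.
have pV : p'^-1 < p^-1 by rewrite ltf_pV2.
(* Any exponent strictly between would do: above 1 / p' for summability, below 1 / p for a positive
   eps. *)
pose q := (p'^-1 + p^-1) / 2.
have pq : p'^-1 < q by rewrite midf_lt.
have qp : q < p^-1 by rewrite midf_lt.
have q0 : 0 < q by rewrite (lt_trans _ pq)// invr_gt0.
have p'q : 1 < p' * q by rewrite mulrC -ltr_pdivrMr// mul1r.
have [m [M [m0 sP]]] := periodic_bounds sc s0 sper.
have [lam_dec lam0 _] := eigval_seqP cT.
have [mu_dec mu0 _] := eigval_seqP cT'.
have lamfin t : 0 < t -> finite_set [set n | t < eigval_seq T n].
  exact: eigval_seq_finite.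
have mufin t : 0 < t -> finite_set [set n | t < eigval_seq T' n].
  exact: eigval_seq_finite.
have mu_sum : cvgn (series (fun k => eigval_seq T' k `^ q)).
  move/eqO_exP: N'O => [C C0 /near_at_right0[d d0 hd]].
  apply: (cvg_series_powR_of_counting mu_dec mu0 mufin p'0 p'q (ltW C0) d0).
  move=> t t0 td; have := hd t t0 td.
  by rewrite [X in X <= _]ger0_norm// [X in _ <= _ * X]ger0_norm ?powR_ge0.
have Lam0 : 0 < eigval_seq T 0 + 1 by rewrite ltr_wpDl.
have Nmono t u : 0 < t -> t <= u -> counting_function T u <= counting_function T t.
  move=> t0 tu; rewrite ler_nat; apply: fsubset_leq_card.
  rewrite -fset_set_sub; [|exact: lamfin (lt_le_trans t0 tu)|exact: lamfin].
  by move=> n /=; exact: le_lt_trans.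
have NLam t : eigval_seq T 0 + 1 <= t -> counting_function T t = 0.
  move=> lt; rewrite /counting_function (_ : [set n | _] = set0) ?fset_set0 ?cardfs0//.
  apply/seteqP; split=> // n /=; apply/negP; rewrite -leNgt (le_trans _ lt)//.
  by rewrite (le_trans (lam_dec _ _ (leq0n n)))// lerDl.
have NAE t : 0 < t -> exists K, forall n, (K <= n)%N ->
    counting_function A t = \sum_(0 <= k < n)
      (if 0 < eigval_seq T' k then counting_function T (t / eigval_seq T' k) else 0).
  (* From this [K] on, every product of eigenvalues is at most [t]; the divisor exceeds the top
     eigenvalue of [T] by 1 and so is positive. *)
  move=> t0; have [K hK] := exists_lt_of_finite (divr_gt0 t0 Lam0) mufin.
  exists K => n Kn; rewrite (tensor_counting_function TA t0 cT cT').
  apply: (card_product_pairs lam_dec mu0 lamfin t0) => k nk.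
  have muk : eigval_seq T' k <= t / (eigval_seq T 0 + 1).
    by rewrite (le_trans _ (ltW hK))//; apply: mu_dec; exact: leq_trans nk.
  rewrite (le_trans (ler_wpM2l (lam0 0%N) muk))// mulrCA ger_pMr//.
  by rewrite ler_pdivrMr// mul1r lerDl.
split.
- exact: tensor_op_compact_nonneg TA cT cT'.
- move=> tau; exact: (cvg_s_star qp m0 sP mu_dec mu0 mu_sum).
- have [per0 sp] := sper; split=> // tau; rewrite /s_star.
  congr (limn (series _)); apply/funext => k; rewrite /s_star_term.
  by case: ifP => // _; rewrite addrAC sp.
- have N0 t : 0 <= counting_function T t by exact: ler0n.
  exact: (product_counting_asymptotics q0 qp phiP m0 sP N0 Lam0 Nmono NLam
    Nasym mu_dec mu0 mu_sum NAE).
Qed.
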